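(* There exist absolute constants $C_1, C_2, C_3>0$ such that the following holds. Let $n,M\ge 1$, $\sigma>0$, $\mu\in\mathbb{R}^n$, and let $y=\mu+\varepsilon$ with $\varepsilon\sim N(0,\sigma^2 I_{n\times n})$. Let $\{A_1,\dots,A_M\}$ be a (deterministic) family of ordered linear smoothers in $\mathbb{R}^{n\times n}$. Let $\hat\theta$ be a solution of the optimization problem $$\hat\theta \in \mathop{\rm arg\,min}_{\theta\in\Lambda_M}\Big( C_p(A_\theta) + \frac12\sum_{j=1}^M \theta_j\|(A_\theta-A_j)y\|^2\Big).$$ Then $$\mathbb{E}\big[\|A_{\hat\theta}y-\mu\|^2\big] - \min_{j=1,\dots,M}\mathbb{E}\big[\|A_jy-\mu\|^2\big]\le C_1\sigma^2 .$$ Furthermore, if $j_*\in\mathop{\rm arg\,min}_{j=1,\dots,M}\mathbb{E}[\|A_jy-\mu\|^2]$, then for any $x\ge 1$, $$\mathbb{P}\big\{\|A_{\hat\theta}y-\mu\|^2-\|A_{j_*}y-\mu\|^2\le C_2\sigma^2x\big\}\ge 1-C_3e^{-x}.$$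
   Context: $\|\cdot\|$ is the Euclidean norm on $\mathbb{R}^n$. ''Absolute constant'' means a number not depending on any other quantity ($n$, $M$, $\mu$, $\sigma$, the matrices, $x$). Ordered linear smoothers: a family $\{A_1,\dots,A_M\}$ of real $n\times n$ matrices is a family of ordered linear smoothers if (i) each $A_j$ is symmetric and $0\le w^TA_jw\le\|w\|^2$ for all $w\in\mathbb{R}^n$; (ii) $A_jA_k=A_kA_j$ for all $j,k$; (iii) for all $j,k$, either $A_j\preceq A_k$ or $A_k\preceq A_j$, where $A\preceq B$ means that $B-A$ is positive semi-definite. Simplex: $\Lambda_M=\{\theta\in\mathbb{R}^M:\theta_j\ge0,\ \sum_{j=1}^M\theta_j=1\}$. For $\theta\in\Lambda_M$, $A_\theta=\sum_{j=1}^M\theta_jA_j$. Mallows' criterion: $C_p(A)=\|Ay-y\|^2+2\sigma^2\,\mathrm{trace}(A)$ for any $n\times n$ matrix $A$. *)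

(* Defs.v *)
From HB Require Import structures.
From mathcomp Require Import all_boot all_order all_algebra.
From mathcomp Require Import all_classical all_reals all_analysis.

Set Implicit Arguments.
Unset Strict Implicit.
Unset Printing Implicit Defensive.

Import Order.TTheory GRing.Theory Num.Theory.
Import numFieldNormedType.Exports.

Local Open Scope classical_set_scope.
Local Open Scope ring_scope.

(* The library's norm on matrices is the sup norm. *)
Definition enorm {R : realType} {n : nat} (v : 'cV[R]_n) : R :=
  Num.sqrt (\sum_i v i 0 ^+ 2).

Definition qform {R : realType} {n : nat} (A : 'M[R]_n) (w : 'cV[R]_n) : R :=
  (w^T *m A *m w) 0 0.

Definition psd {R : realType} {n : nat} (A : 'M[R]_n) : Prop :=
  A^T = A /\ forall w : 'cV[R]_n, 0 <= qform A w.

Definition loewner_le {R : realType} {n : nat} (A B : 'M[R]_n) : Prop :=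
  psd (B - A).

Definition ordered_linear_smoothers {R : realType} {n M : nat}
    (A : 'I_M -> 'M[R]_n) : Prop :=
  [/\ forall j, (A j)^T = A j /\
        forall w : 'cV[R]_n, 0 <= qform (A j) w <= enorm w ^+ 2,
      forall j k, A j *m A k = A k *m A j &
      forall j k, loewner_le (A j) (A k) \/ loewner_le (A k) (A j)].

Definition simplex (R : realType) (M : nat) : set 'cV[R]_M :=
  [set theta | (forall j, 0 <= theta j 0) /\ \sum_j theta j 0 = 1].

Definition Amix {R : realType} {n M : nat} (A : 'I_M -> 'M[R]_n)
    (theta : 'cV[R]_M) : 'M[R]_n :=
  \sum_j theta j 0 *: A j.

Definition mallows_Cp {R : realType} {n : nat} (sigma : R) (y : 'cV[R]_n)
    (A : 'M[R]_n) : R :=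
  enorm (A *m y - y) ^+ 2 + 2 * sigma ^+ 2 * \tr A.

Definition Qagg_criterion {R : realType} {n M : nat} (sigma : R)
    (A : 'I_M -> 'M[R]_n) (y : 'cV[R]_n) (theta : 'cV[R]_M) : R :=
  mallows_Cp sigma y (Amix A theta) +
  2^-1 * \sum_j theta j 0 * enorm ((Amix A theta - A j) *m y) ^+ 2.

Definition argmin {disp : Order.disp_t} {V : porderType disp} {X : Type}
    (D : set X) (f : X -> V) : set X :=
  [set x | D x /\ forall z, D z -> (f x <= f z)%O].

Definition mutually_independent {d : measure_display} {T : measurableType d}
    {R : realType} (P : probability T R) {I : finType}
    (X : I -> {RV P >-> R}) : Prop :=
  forall (J : {set I}) (B : I -> set R), (forall i, measurable (B i)) ->
    (P (\bigcap_(i in [set` J]) (X i @^-1` B i)) =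
     \prod_(i in J) P (X i @^-1` B i))%E.

(* The law N(0, sigma^2 I_n); the second parameter of [normal_prob] is the
   standard deviation.  Laws are compared on measurable sets only, since the
   two set functions need not agree elsewhere. *)
Definition isotropic_gaussian {d : measure_display} {T : measurableType d}
    {R : realType} (P : probability T R) {n : nat} (sigma : R)
    (eps : 'I_n -> {RV P >-> R}) : Prop :=
  mutually_independent eps /\
  forall i (B : set R), measurable B ->
    distribution P (eps i) B = normal_prob 0 sigma B.

(* Main.v *)
(* The penalty turns the criterion into half the squared norm of A_theta y plus a
   linear function of theta.  Testing its minimality in the direction of the
   vertex j bounds the regret against A_j by the theta-average of
     Z_k = 2 eps^T (A_k - A_j) y - 2 sigma^2 tr (A_k - A_j) - |(A_k - A_j) y|^2 / 2,
   so it suffices to bound E exp (t sup_k Z_k / sigma^2) by an absolute constant.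
   Up to its mean, Z_k is a Gaussian linear form plus a centred quadratic form;
   it has drift - D_k / 2, where D_k = delta (k, j)^2 and
   delta (k, l)^2 = |(A_k - A_l) mu / sigma|^2 + |A_k - A_l|_F^2, and increments
   that are sub-exponential at scale delta (k, l).  Because the A_k commute and
   are totally ordered, delta^2 is superadditive along the order, so that
   delta (k, l)^2 <= 2 |D_k - D_l| once D is given a sign according to the side
   of j on which k lies: the process behaves like a random walk run at time D.
   Chaining on blocks of unit D-length and a union over the blocks, where the
   drift produces a geometric series, give the bound whatever M is.
   No spectral decomposition is used: products of commuting positive matrices
   are handled by Riesz's argument, and the exponential moments of Gaussian
   quadratic forms by integrating out one coordinate at a time. *)

Require Import Defs.
From HB Require Import structures.
From mathcomp Require Import all_boot all_order all_algebra.
From mathcomp Require Import all_classical all_reals all_analysis.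
From mathcomp Require Import measurable_realfun.
From mathcomp Require Import ring lra.

Import Order.TTheory GRing.Theory Num.Theory.
Import numFieldNormedType.Exports.

Local Open Scope classical_set_scope.
Local Open Scope ring_scope.

(** * Frobenius inner product and positive semi-definite matrices *)

Section frobenius.
Set Implicit Arguments.
Unset Strict Implicit.
Context {R : realType}.

Definition ip {n p : nat} (X Y : 'M[R]_(n, p)) : R := \tr (X^T *m Y).
Definition fnorm {n p : nat} (X : 'M[R]_(n, p)) : R := Num.sqrt (ip X X).

Lemma ipE n p (X Y : 'M[R]_(n, p)) : ip X Y = \sum_j \sum_i X i j * Y i j.
Proof.
rewrite /ip /mxtrace; apply: eq_bigr => j _; rewrite !mxE.
by apply: eq_bigr => i _; rewrite !mxE.
Qed.

Lemma ipC n p (X Y : 'M[R]_(n, p)) : ip X Y = ip Y X.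
Proof. by rewrite /ip -mxtrace_tr trmx_mul trmxK. Qed.

Lemma ipDr n p (X Y Z : 'M[R]_(n, p)) : ip X (Y + Z) = ip X Y + ip X Z.
Proof. by rewrite /ip mulmxDr mxtraceD. Qed.

Lemma ipDl n p (X Y Z : 'M[R]_(n, p)) : ip (Y + Z) X = ip Y X + ip Z X.
Proof. by rewrite !(ipC _ X) ipDr. Qed.

Lemma ipZr n p a (X Y : 'M[R]_(n, p)) : ip X (a *: Y) = a * ip X Y.
Proof. by rewrite /ip -scalemxAr mxtraceZ. Qed.

Lemma ipZl n p a (X Y : 'M[R]_(n, p)) : ip (a *: X) Y = a * ip X Y.
Proof. by rewrite ipC ipZr ipC. Qed.

Lemma ipNr n p (X Y : 'M[R]_(n, p)) : ip X (- Y) = - ip X Y.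
Proof. by rewrite -scaleN1r ipZr mulN1r. Qed.

Lemma ipNl n p (X Y : 'M[R]_(n, p)) : ip (- X) Y = - ip X Y.
Proof. by rewrite ipC ipNr ipC. Qed.

Lemma ip0l n p (X : 'M[R]_(n, p)) : ip 0 X = 0.
Proof. by rewrite /ip trmx0 mul0mx mxtrace0. Qed.

Lemma ip_suml n p (I : finType) (F : I -> 'M[R]_(n, p)) X :
  ip (\sum_i F i) X = \sum_i ip (F i) X.
Proof.
by rewrite /ip linear_sum /= mulmx_suml linear_sum.
Qed.

Lemma ip_sumr n p (I : finType) (F : I -> 'M[R]_(n, p)) X :
  ip X (\sum_i F i) = \sum_i ip X (F i).
Proof. by rewrite ipC ip_suml; apply: eq_bigr => i _; rewrite ipC. Qed.

Lemma ip_ge0 n p (X : 'M[R]_(n, p)) : 0 <= ip X X.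
Proof.
by rewrite ipE sumr_ge0// => j _; rewrite sumr_ge0// => i _; rewrite -expr2 sqr_ge0.
Qed.

Lemma ip_mulA m n p (A : 'M[R]_(m, n)) (X : 'M[R]_(n, p)) (Y : 'M[R]_(m, p)) :
  ip (A *m X) Y = ip X (A^T *m Y).
Proof. by rewrite /ip trmx_mul mulmxA. Qed.

Lemma ip_col n p (X Y : 'M[R]_(n, p)) : ip X Y = \sum_j ip (col j X) (col j Y).
Proof.
rewrite ipE; apply: eq_bigr => j _; rewrite ipE big_ord1.
by apply: eq_bigr => i _; rewrite !mxE.
Qed.

Lemma fnorm_ge0 n p (X : 'M[R]_(n, p)) : 0 <= fnorm X.
Proof. exact: sqrtr_ge0. Qed.

Lemma sqr_fnorm n p (X : 'M[R]_(n, p)) : fnorm X ^+ 2 = ip X X.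
Proof. by rewrite sqr_sqrtr// ip_ge0. Qed.

(** Nonnegativity of |X + t Y|^2 for all real t, used at the minimiser t = - <X, Y> / |Y|^2. *)
Lemma ip_sqr_le n p (X Y : 'M[R]_(n, p)) : ip X Y ^+ 2 <= ip X X * ip Y Y.
Proof.
have h t : 0 <= ip X X + 2 * t * ip X Y + t ^+ 2 * ip Y Y.
  have := ip_ge0 (X + t *: Y).
  by rewrite ipDl !ipDr !ipZl !ipZr (ipC Y X) => /le_trans; apply; lra.
have [y0|y0] := eqVneq (ip Y Y) 0.
  rewrite y0 mulr0; have [xy|xy] := eqVneq (ip X Y) 0; first by rewrite xy expr0n.
  (* When |Y| = 0 the polynomial is affine in t, and this t would give it the value -1. *)
  have := h (- (ip X X + 1) / (2 * ip X Y)); rewrite y0 mulr0 addr0.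
  have -> : 2 * (- (ip X X + 1) / (2 * ip X Y)) * ip X Y = - (ip X X + 1) by field.
  by move=> ?; exfalso; lra.
have yp : 0 < ip Y Y by rewrite lt_neqAle eq_sym y0 ip_ge0.
have := h (- ip X Y / ip Y Y).
have -> : ip X X + 2 * (- ip X Y / ip Y Y) * ip X Y + (- ip X Y / ip Y Y) ^+ 2 * ip Y Y
   = (ip X X * ip Y Y - ip X Y ^+ 2) / ip Y Y by field.
by rewrite pmulr_lge0 ?invr_gt0// subr_ge0.
Qed.

Lemma CauchySchwarz_ip n p (X Y : 'M[R]_(n, p)) : `|ip X Y| <= fnorm X * fnorm Y.
Proof.
rewrite -(@ler_pXn2r _ 2)// ?nnegrE ?mulr_ge0 ?fnorm_ge0//.
by rewrite exprMn !sqr_fnorm real_normK ?num_real// ip_sqr_le.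
Qed.

Lemma ip_le n p (X Y : 'M[R]_(n, p)) : ip X Y <= fnorm X * fnorm Y.
Proof. exact: le_trans (ler_norm _) (CauchySchwarz_ip _ _). Qed.

Lemma fnormD n p (X Y : 'M[R]_(n, p)) : fnorm (X + Y) <= fnorm X + fnorm Y.
Proof.
rewrite -(@ler_pXn2r _ 2)// ?nnegrE ?addr_ge0 ?fnorm_ge0//.
rewrite sqrrD !sqr_fnorm ipDl !ipDr (ipC Y X).
have := ip_le X Y; rewrite mulr2n; lra.
Qed.

Lemma fnormZ n p a (X : 'M[R]_(n, p)) : fnorm (a *: X) = `|a| * fnorm X.
Proof.
by rewrite /fnorm ipZl ipZr mulrA -expr2 sqrtrM ?sqr_ge0// sqrtr_sqr.
Qed.

Lemma fnormN n p (X : 'M[R]_(n, p)) : fnorm (- X) = fnorm X.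
Proof. by rewrite -scaleN1r fnormZ normrN1 mul1r. Qed.

Lemma fnormB n p (X Y : 'M[R]_(n, p)) : fnorm (X - Y) <= fnorm X + fnorm Y.
Proof. by rewrite -(fnormN Y) fnormD. Qed.

Lemma fnorm_le n p (X : 'M[R]_(n, p)) q (Y : 'M[R]_(n, q)) :
  (fnorm X <= fnorm Y) = (ip X X <= ip Y Y).
Proof. by rewrite -!sqr_fnorm ler_pXn2r// nnegrE fnorm_ge0. Qed.

(** Cauchy-Schwarz on each entry, a row of [B] against a column of [X]. For a vector [X] it says
    that the Frobenius norm dominates the operator norm. *)
Lemma fnorm_mulmx_le m p q (B : 'M[R]_(m, p)) (X : 'M[R]_(p, q)) :
  fnorm (B *m X) <= fnorm B * fnorm X.
Proof.
rewrite -(@ler_pXn2r _ 2)// ?nnegrE ?mulr_ge0 ?fnorm_ge0// exprMn !sqr_fnorm.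
rewrite [ip (_ *m _) _]ipE [ip X X]ip_col mulr_sumr ler_sum// => a _.
have -> : ip B B = \sum_i ip (col i B^T) (col i B^T).
  rewrite -ip_col [RHS]/ip trmxK mxtrace_mulC; exact.
rewrite mulr_suml ler_sum// => i _.
rewrite (_ : (B *m X) i a = ip (col i B^T) (col a X)); first by rewrite -expr2 ip_sqr_le.
by rewrite ipE big_ord1 mxE; apply: eq_bigr => b _; rewrite !mxE.
Qed.

Lemma enormE n (v : 'cV[R]_n) : enorm v = fnorm v.
Proof.
by rewrite /enorm /fnorm ipE big_ord1; congr Num.sqrt; apply: eq_bigr => i _; rewrite expr2.
Qed.

Lemma qformE n (A : 'M[R]_n) (w : 'cV[R]_n) : qform A w = ip w (A *m w).
Proof. by rewrite /ip /qform mulmxA /mxtrace big_ord1. Qed.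

End frobenius.

Section psd.
Set Implicit Arguments.
Unset Strict Implicit.
Context {R : realType} {n : nat}.
Implicit Types A B S T : 'M[R]_n.

Lemma psd_ip A p (X : 'M[R]_(n, p)) : psd A -> 0 <= ip X (A *m X).
Proof.
case=> _ h; rewrite ip_col sumr_ge0// => j _.
by rewrite !colE -mulmxA -qformE.
Qed.

Lemma psdD A B : psd A -> psd B -> psd (A + B).
Proof.
move=> [sA pA] [sB pB]; split; first by rewrite linearD /= sA sB.
by move=> w; rewrite qformE mulmxDl ipDr -!qformE addr_ge0.
Qed.

Lemma psd_conj A B : B^T = B -> psd A -> psd (B *m A *m B).
Proof.
move=> sB pA; split; first by rewrite !trmx_mul sB pA.1 mulmxA.
by move=> w; rewrite qformE -!mulmxA -{1}sB -ip_mulA psd_ip.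
Qed.

Lemma psd_sqr A : A^T = A -> psd (A *m A).
Proof.
move=> sA; split; first by rewrite trmx_mul sA.
by move=> w; rewrite qformE -mulmxA -{1}sA -ip_mulA ip_ge0.
Qed.

(** S - S^2 = S (1 - S) S + (1 - S) S (1 - S), a sum of congruences of positive matrices. *)
Lemma psd_subsqr S : psd S -> psd (1%:M - S) -> psd (S - S *m S).
Proof.
move=> pS pC.
have -> : S - S *m S = S *m (1%:M - S) *m S + (1%:M - S) *m S *m (1%:M - S).
  rewrite !(mulmxBl, mulmxBr, mul1mx, mulmx1).
  by rewrite -!mulmxA; rewrite opprB !addrA;
    apply/matrixP => i j; rewrite !mxE; ring.
by apply: psdD; apply: psd_conj => //; [exact: pS.1|exact: pC.1].
Qed.

Lemma psd_contract S p (X : 'M[R]_(n, p)) : psd S -> psd (1%:M - S) ->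
  fnorm (S *m X) <= fnorm X.
Proof.
move=> pS pC; rewrite fnorm_le.
have := psd_ip X (psd_subsqr pS pC); have := psd_ip X pC.
rewrite !mulmxBl !ipDr !ipNr mul1mx -mulmxA.
rewrite -{3}(pS.1) -ip_mulA; lra.
Qed.

Fixpoint riesz_seq S k :=
  if k is k'.+1 then riesz_seq S k' - riesz_seq S k' *m riesz_seq S k' else S.

(* Riesz's argument: with S_0 = S and S_(k+1) = S_k - S_k^2 one has
   S T = sum_(k < m) S_k T S_k + S_m T, and S_m X becomes arbitrarily small
   since the squared norms of the S_k X are summable. *)
Lemma psd_mul_ip S T p (X : 'M[R]_(n, p)) :
  psd S -> psd (1%:M - S) -> psd T -> S *m T = T *m S ->
  0 <= ip X (S *m (T *m X)).
Proof.
move=> pS pC pT cST; set s := riesz_seq S.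
have inv k : [/\ psd (s k), psd (1%:M - s k) & s k *m T = T *m s k].
  elim: k => [|k [h1 h2 h3]]; first by [].
  rewrite /s /= -/(s k); split.
  - exact: psd_subsqr.
  - rewrite opprB addrA; rewrite [_ + _ - _]addrAC; apply: psdD => //.
    by apply: psd_sqr; exact: h1.1.
  - by rewrite mulmxBl mulmxBr h3 -mulmxA h3 !mulmxA h3.
have sum1 m : ip X (S *m X) = \sum_(k < m) ip (s k *m X) (s k *m X) + ip X (s m *m X).
  elim: m => [|m IH]; first by rewrite big_ord0 add0r.
  rewrite IH big_ord_recr /= /s /= -/(s m) mulmxBl ipDr ipNr -addrA; congr (_ + _).
  have [[h1 _] _ _] := inv m.
  by rewrite ip_mulA h1 mulmxA addrC subrK.
have sum2 m : ip X (S *m (T *m X)) = \sum_(k < m) ip (s k *m X) (T *m (s k *m X))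
    + ip X (s m *m (T *m X)).
  elim: m => [|m IH]; first by rewrite big_ord0 add0r.
  rewrite IH big_ord_recr /= /s /= -/(s m) mulmxBl ipDr ipNr -addrA; congr (_ + _).
  have [[h1 _] _ h3] := inv m.
  rewrite ip_mulA h1 (mulmxA T) -h3 -!mulmxA addrC subrK//.
rewrite leNgt; apply/negP => neg.
set c := ip X (S *m (T *m X)) in neg.
pose t := ip (T *m X) (T *m X).
(* The sum in [sum2] is nonnegative, so every remainder is at most the negative number c;
   Cauchy-Schwarz then keeps |S_m X|^2 above c^2 / t for all m, against the summability in
   [sum1]. *)
have cle m : c ^+ 2 <= ip (s m *m X) (s m *m X) * t.
  have [[h1 _] _ h3] := inv m.
  have le0 : ip X (s m *m (T *m X)) <= c.
    by rewrite /c (sum2 m) lerDr sumr_ge0// => k _; exact: psd_ip.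
  apply: le_trans (ip_sqr_le _ _).
  rewrite ip_mulA h1 -(sqrrN c) -(sqrrN (ip _ _)) ler_pXn2r// ?nnegrE; lra.
have t0 : 0 < t.
  rewrite lt_neqAle ip_ge0 andbT; apply/negP => /eqP t0.
  have := cle 0; rewrite -t0 mulr0 leNgt exprn_even_gt0//=; last by rewrite lt_eqF.
have bnd m : m%:R * (c ^+ 2 / t) <= ip X (S *m X).
  rewrite (sum1 m); have [h1 _ _] := inv m.
  have := psd_ip X h1; suff : m%:R * (c ^+ 2 / t) <= \sum_(k < m) ip (s k *m X) (s k *m X) by lra.
  rewrite mulr_natl -[X in _ *+ X]card_ord -sumr_const ler_sum// => k _.
  by rewrite ler_pdivrMr.
have cp : 0 < c ^+ 2 / t by rewrite divr_gt0// exprn_even_gt0//= lt_eqF.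
have := bnd (Num.bound (ip X (S *m X) / (c ^+ 2 / t))).
apply/negP; rewrite -ltNge -ltr_pdivrMr//.
by apply: archi_boundP; rewrite divr_ge0 ?(ltW cp)// psd_ip.
Qed.

End psd.

(** * Gaussian integrals *)

Section gaussian_integral.
Set Implicit Arguments.
Unset Strict Implicit.
Context {R : realType}.
Variable s : R.
Hypothesis s_gt0 : 0 < s.

(** The change of variables produces the Radon-Nikodym derivative, which equals the explicit density
    almost everywhere because both have the same integral over every measurable set. *)
Lemma integral_normal_prob (f : R -> \bar R) :
  measurable_fun setT f -> (forall x, 0 <= f x)%E ->
  (\int[normal_prob 0 s]_x f x =
   \int[lebesgue_measure]_x (f x * (normal_pdf 0 s x)%:E))%E.
Proof.
move=> mf f0.
pose nu : probability _ R := normal_prob 0 s.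
have dom : nu `<< lebesgue_measure by exact: normal_prob_dominates.
rewrite -(Radon_Nikodym_SigmaFinite.change_of_variables dom)//.
have fi := Radon_Nikodym_SigmaFinite.f_integrable dom.
have mp : measurable_fun setT (fun x : R => (normal_pdf 0 s x)%:E).
  by apply/measurable_EFinP; exact: measurable_normal_pdf.
apply: ae_eq_integral => //.
- by apply: emeasurable_funM => //; exact: (measurable_int _ fi).
- exact: emeasurable_funM.
- have : ae_eq lebesgue_measure setT (Radon_Nikodym_SigmaFinite.f nu lebesgue_measure)
      (fun x : R => (normal_pdf 0 s x)%:E).
    apply: integral_ae_eq => // A _ mA.
    by rewrite -Radon_Nikodym_SigmaFinite.f_integral.
  by apply: filterS => x /= /(_ I) ->.
Qed.

(** Completing the square: with c = 1 - 2 q > 0, the integrand times the density is the stated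
    constant times the normal density of mean b / c and standard deviation s / sqrt c. *)
Lemma normal_quad_mgf (q b : R) : q < 2^-1 ->
  (\int[normal_prob 0 s]_x (expR ((q * x ^+ 2 + b * x) / s ^+ 2))%:E =
   (expR (b ^+ 2 / (2 * (1 - 2 * q) * s ^+ 2)) / Num.sqrt (1 - 2 * q))%:E)%E.
Proof.
move=> q2; have c0 : 0 < 1 - 2 * q by lra.
set c := 1 - 2 * q; rewrite -/c in c0.
have sc0 : 0 < Num.sqrt c by rewrite sqrtr_gt0.
have s2 : s ^+ 2 != 0 by rewrite expf_neq0// gt_eqF.
rewrite integral_normal_prob//; last first.
  apply/measurable_EFinP; apply: measurableT_comp => //.
  by apply: measurable_funM => //; apply: measurable_funD; apply: measurable_funM => //.
pose s' := s / Num.sqrt c.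
have s'0 : s' != 0 by rewrite mulf_neq0 ?invr_neq0// gt_eqF.
rewrite (_ : (fun x => _) = (fun x => (expR (b ^+ 2 / (2 * c * s ^+ 2)) / Num.sqrt c)%:E *
    (normal_pdf (b / c) s' x)%:E)%E).
  rewrite ge0_integralZl//.
  - by rewrite integral_normal_pdf mule1.
  - by apply/measurable_EFinP; exact: measurable_normal_pdf.
  - by move=> x _; exact: normal_pdf_ge0.
apply/funext => x; rewrite -!EFinM; congr EFin.
rewrite !normal_pdfE// ?gt_eqF// /normal_peak /normal_fun.
have s'2 : s' ^+ 2 = s ^+ 2 / c by rewrite expr_div_n sqr_sqrtr// ltW.
rewrite s'2.
have -> : Num.sqrt (s ^+ 2 / c * pi *+ 2) = Num.sqrt (s ^+ 2 * pi *+ 2) / Num.sqrt c.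
  rewrite (_ : s ^+ 2 / c * pi *+ 2 = s ^+ 2 * pi *+ 2 / c); last by rewrite mulrAC mulrnAl.
  rewrite sqrtrM; first by rewrite sqrtrV// ltW.
  by rewrite mulrn_wge0// mulr_ge0 ?sqr_ge0// pi_ge0.
have K0 : Num.sqrt (s ^+ 2 * pi *+ 2) != 0.
  by rewrite gt_eqF// sqrtr_gt0 mulrn_wgt0// mulr_gt0 ?pi_gt0// exprn_gt0.
set K := Num.sqrt (_ *+ 2) in K0 *.
set E1 := expR _; set E2 := expR _; set E3 := expR _; set E4 := expR _.
have E : E1 * E2 = E3 * E4.
  rewrite /E1 /E2 /E3 /E4 -!expRD; congr expR; rewrite subr0.
  by rewrite /c; field; rewrite -/c !gt_eqF.
rewrite mulrCA E; field.
by rewrite K0 gt_eqF.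
Qed.

End gaussian_integral.

(** * Independence of the first coordinate from the remaining ones *)

Section head_tail_independence.
Set Implicit Arguments.
Unset Strict Implicit.
Context d (T : measurableType d) (R : realType) (P : probability T R) (n : nat).
Variable X : 'I_n.+1 -> {RV P >-> R}.

Definition tail_cylinders : set (set T) := [set A | exists B : 'I_n -> set R,
  (forall i, measurable (B i)) /\ A = \bigcap_i (X (lift ord0 i) @^-1` B i)].

(** The sample space with a coarser sigma-algebra: measurability on [tail_type] expresses that a
    function depends on the tail coordinates alone. *)
Definition tail_type := g_sigma_algebraType tail_cylinders.

Lemma tail_cylinders_measurable : tail_cylinders `<=` measurable.
Proof.
move=> _ [B [mB ->]]; apply: fin_bigcap_measurable => // i _.
by rewrite -[_ @^-1` _]setTI; exact: measurable_funP.
Qed.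

Lemma tail_cylindersI : setI_closed tail_cylinders.
Proof.
move=> _ _ [B [mB ->]] [C [mC ->]]; exists (fun i => B i `&` C i); split.
  by move=> i; exact: measurableI.
by rewrite -bigcapI; apply: eq_bigcapr => i _; rewrite preimage_setI.
Qed.

Lemma measurable_tail (i : 'I_n) :
  measurable_fun [set: tail_type] (X (lift ord0 i) : tail_type -> R).
Proof.
move=> _ B mB; rewrite setTI; apply: sub_sigma_algebra.
exists (fun j => if j == i then B else setT); split.
  by move=> j; case: ifP.
apply/seteqP; split => [w /= Bw j _ /=|w /= /(_ i I)]; last by rewrite eqxx.
by case: eqP => // ->.
Qed.

Let totail : T -> tail_type := id.

Lemma measurable_to_tail : measurable_fun setT totail.
Proof.
move=> _ B mB; rewrite setTI.
by apply: (smallest_sub (@sigma_algebra_measurable _ T) tail_cylinders_measurable).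
Qed.

HB.instance Definition _ := isMeasurableFun.Build _ _ _ _ totail measurable_to_tail.

Let joint (w : T) : tail_type * R := (totail w, X ord0 w).

Let measurable_joint : measurable_fun setT joint.
Proof. by apply: measurable_fun_pair => //; exact: measurable_to_tail. Qed.

HB.instance Definition _ := isMeasurableFun.Build _ _ _ _ joint measurable_joint.

Hypothesis indep : mutually_independent X.

(** For fixed [B] both sides are finite measures in [A]; they agree on the cylinders, a pi-system,
    hence on the sigma-algebra that these generate. *)
Let indep_head (A : set T) (B : set R) : <<s tail_cylinders >> A -> measurable B ->
  (P (A `&` X ord0 @^-1` B) = P A * P (X ord0 @^-1` B))%E.
Proof.
move=> sA mB.
have mXB : measurable (X ord0 @^-1` B).
  by rewrite -[_ @^-1` _]setTI; exact: measurable_funP.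
pose c : {nonneg R} := NngNum (fine_ge0 (measure_ge0 P (X ord0 @^-1` B))).
pose m1 : {measure set T -> \bar R} := mrestr P mXB.
pose m2 : {measure set T -> \bar R} := mscale c P.
suff : m1 A = m2 A.
  rewrite /m1 /m2 /= /mrestr /mscale /= => ->.
  rewrite fineK; first exact: muleC.
  exact: fin_num_measure.
apply: (g_sigma_algebra_measure_unique tail_cylinders tail_cylinders_measurable (fun=> setT)) => //.
- move=> _; exists (fun=> setT); split=> //.
  by apply/seteqP; split.
- by rewrite bigcup_const.
- exact: tail_cylindersI.
- move=> _ [C [mC ->]]; rewrite /m1 /m2 /= /mrestr /mscale /= fineK ?fin_num_measure//.
  pose D (i : 'I_n.+1) := if unlift ord0 i is Some j then C j else B.
  have mD i : measurable (D i) by rewrite /D; case: unliftP.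
  have mP i E : measurable E -> measurable (X i @^-1` E).
    by move=> mE; rewrite -[_ @^-1` _]setTI; exact: measurable_funP.
  (* The product formulas for all coordinates and for all but the first differ by the single factor
     of [X ord0]. *)
  have h1 := @indep finset.setT D mD.
  have h2 := @indep (finset.setC (finset.set1 ord0)) D mD.
  have E1 : \bigcap_i (X (lift ord0 i) @^-1` C i) =
     \bigcap_(i in [set` [set~ ord0 : 'I_n.+1]%SET]) (X i @^-1` D i).
    apply/seteqP; split => w /= h i.
      rewrite /= !inE; case: (unliftP ord0 i) => [j -> _|->]; last by rewrite eqxx.
      by rewrite /= /D liftK; exact: h.
    move=> _; have := h (lift ord0 i); rewrite /D liftK; apply.
    by rewrite /= !inE eq_sym neq_lift.
  have E2 : \bigcap_i (X (lift ord0 i) @^-1` C i) `&` X ord0 @^-1` B =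
     \bigcap_(i in [set` [set: 'I_n.+1]%SET]) (X i @^-1` D i).
    rewrite E1; apply/seteqP; split => w /=.
      move=> [h hB] i _; case: (unliftP ord0 i) => [j ij|->].
        by apply: h; rewrite /= !inE ij eq_sym neq_lift.
      by rewrite /D unlift_none.
    move=> h; split => [i _|]; first by apply: h; rewrite /= inE.
    by have := h ord0; rewrite /D unlift_none; apply; rewrite /= inE.
  rewrite E2 h1 E1 h2 [LHS](bigD1 ord0) ?inE//= {1}/D unlift_none.
  by congr (_ * _)%E; apply: eq_bigl => i; rewrite !inE.
- by move=> _; rewrite /m1 /= /mrestr setTI ltey_eq fin_num_measure.
Qed.

(** The joint law of the tail and of [X ord0] is the product of their laws, so Tonelli integrates
    out the first coordinate with the others frozen at [w]. *)
Lemma integral_head_tail (F : tail_type * R -> \bar R) :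
  measurable_fun setT F -> (forall z, 0 <= F z)%E ->
  (\int[P]_w F (w, X ord0 w) = \int[P]_w \int[distribution P (X ord0)]_t F (w, t))%E.
Proof.
move=> mF F0.
pose m1 : probability tail_type R := distribution P totail.
pose m2 : probability R R := distribution P (X ord0).
pose mj : {measure set (tail_type * R) -> \bar R} := distribution P joint.
pose mp : {measure set (tail_type * R) -> \bar R} := (m1 \x m2)%E.
transitivity (\int[mj]_z F z)%E.
  by rewrite /mj ge0_integral_distribution.
transitivity (\int[mp]_z F z)%E.
  apply: (@eq_measure_integral _ _ _ setT mp mj F) => A mA _; apply/esym.
  by apply: product_measure_unique => //= B C; exact: indep_head.
rewrite /mp (fubini_tonelli1 F)//.
rewrite ge0_integral_distribution//.
- exact: measurable_fun_fubini_tonelli_F.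
- by move=> w; apply: integral_ge0 => t _.
Qed.

End head_tail_independence.

Section gaussian_law.
Set Implicit Arguments.
Unset Strict Implicit.
Context d (T : measurableType d) (R : realType) (P : probability T R).
Variables (X : {RV P >-> R}) (s : R).
Hypothesis Xlaw : forall B : set R, measurable B ->
  distribution P X B = normal_prob 0 s B.

(* [R] and [measurableTypeR R] have the same measurable sets but different
   displays, hence the detour through a second copy of X. *)
Let X' : T -> measurableTypeR R := X.

Let measurable_X' : measurable_fun setT X'.
Proof. by move=> mT B mB; apply: (measurable_funP X). Qed.

HB.instance Definition _ := isMeasurableFun.Build _ _ _ _ X' measurable_X'.

Lemma integral_gaussian_law (f : R -> \bar R) :
  measurable_fun setT f -> (forall x, 0 <= f x)%E ->
  (\int[distribution P X]_x f x = \int[normal_prob 0 s]_x f x)%E.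
Proof.
move=> mf f0; rewrite ge0_integral_distribution//.
transitivity (\int[distribution P X']_x f x)%E.
  by rewrite ge0_integral_distribution.
by apply: eq_measure_integral => A mA _; exact: Xlaw.
Qed.

End gaussian_law.

(** * Exponential moments of Gaussian forms *)

Section gaussian_mgf.
Set Implicit Arguments.
Unset Strict Implicit.
Context {R : realType}.

Lemma ip_col_mx m n p (a c : 'M[R]_(m, p)) (b e : 'M[R]_(n, p)) :
  ip (col_mx a b) (col_mx c e) = ip a c + ip b e.
Proof. by rewrite /ip tr_col_mx mul_row_col mxtraceD. Qed.

Lemma ip_scalar1 (a b : R) : ip (a%:M : 'M[R]_1) b%:M = a * b.
Proof. by rewrite /ip tr_scalar_mx -scalar_mxM mxtrace_scalar. Qed.

Lemma trmul_ip n (u x : 'cV[R]_n) : u^T *m x = (ip u x)%:M.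
Proof. by rewrite [LHS]mx11_scalar /ip /mxtrace big_ord1. Qed.

Lemma ip_outer n (u x : 'cV[R]_n) : ip x (u *m u^T *m x) = ip u x ^+ 2.
Proof.
by rewrite -mulmxA -[X in X *m (_ *m _)]trmxK -ip_mulA trmul_ip ip_scalar1.
Qed.

Lemma sym_blockP n (Q : 'M[R]_n.+1) : Q^T = Q ->
  exists q (u : 'cV[R]_n) (M : 'M[R]_n), M^T = M /\ Q = block_mx q%:M u^T u M :> 'M[R]_(1 + n).
Proof.
move=> sQ; pose Q' : 'M[R]_(1 + n) := Q.
have sQ' : Q'^T = Q' by [].
exists (Q' 0 0), (dlsubmx Q'), (drsubmx Q'); split; first by rewrite trmx_drsub sQ'.
rewrite -[LHS](@submxK _ 1 n 1 n) -/Q'; congr block_mx.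
  by rewrite [LHS]mx11_scalar !mxE; congr (_%:M); congr (Q' _ _); apply: val_inj.
by rewrite trmx_dlsub sQ'.
Qed.

Lemma ip_block_form n (q : R) (u : 'cV[R]_n) M (t : R) (x : 'cV[R]_n) :
  ip (col_mx t%:M x) ((block_mx q%:M u^T u M : 'M[R]_(1 + n)) *m col_mx t%:M x) =
  q * t ^+ 2 + 2 * ip u x * t + ip x (M *m x).
Proof.
rewrite mul_block_col ip_col_mx trmul_ip -scalar_mxM !ipDr !ip_scalar1.
rewrite mul_mx_scalar ipZr (ipC x u); ring.
Qed.

Lemma ip_block n (q : R) (u : 'cV[R]_n) M :
  ip (block_mx q%:M u^T u M : 'M[R]_(1 + n)) (block_mx q%:M u^T u M) =
  q ^+ 2 + 2 * ip u u + ip M M.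
Proof.
rewrite {1}/ip tr_block_mx mulmx_block mxtrace_block !mxtraceD.
rewrite -[\tr (_ *m q%:M)]/(ip _ _) ip_scalar1 trmxK [\tr (u *m u^T)]mxtrace_mulC.
rewrite -/(ip u u) -/(ip M M); ring.
Qed.

(** As 1 + z <= e^z, it is enough that (1 + q + 2 q^2)^2 (1 - 2 q) >= 1; the difference is q^2 times
    a polynomial that is positive for |q| <= 1/8. *)
Lemma inv_sqrt_le_expR (q : R) : `|q| <= 8^-1 ->
  (Num.sqrt (1 - 2 * q))^-1 <= expR (q + 2 * q ^+ 2).
Proof.
rewrite ler_norml => /andP[q1 q2].
have c0 : 0 < 1 - 2 * q by lra.
have z0 : 0 < 1 + q + 2 * q ^+ 2 by nra.
apply: (@le_trans _ _ (1 + q + 2 * q ^+ 2)); last first.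
  by have := expR_ge1Dx (q + 2 * q ^+ 2); rewrite addrA.
rewrite -(@ler_pXn2r _ 2)// ?nnegrE ?invr_ge0 ?sqrtr_ge0 ?(ltW z0)//.
rewrite exprVn sqr_sqrtr ?(ltW c0)// -[_^-1]mul1r ler_pdivrMr//.
rewrite -subr_ge0.
have -> : (1 + q + 2 * q ^+ 2) ^+ 2 * (1 - 2 * q) - 1 =
   q ^+ 2 * (1 - 6 * q - 4 * q ^+ 2 - 8 * q ^+ 3) by ring.
rewrite mulr_ge0 ?sqr_ge0//.
have : q ^+ 3 <= 8^-1 * 8^-1 ^+ 2.
  have [q0|q0] := leP 0 q; last by rewrite exprS; nra.
  by rewrite exprS ler_pM ?sqr_ge0//; nra.
nra.
Qed.

(* M + k u u^T is the form left after integrating out the first coordinate t.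
   As for a Schur complement the two-sided bound survives, because its value at
   x is the maximum over t, attained at t = k <u, x>, of the block form at
   (t, x) minus t^2 / 2. *)
Lemma quad_elimination n (q : R) (u : 'cV[R]_n) (M : 'M[R]_n) (k := 2 / (1 - 2 * q)) :
  M^T = M ->
  (forall w : 'cV[R]_(1 + n), `|ip w (block_mx q%:M u^T u M *m w)| <= ip w w / 8) ->
  [/\ `|q| <= 8^-1,
    forall x : 'cV[R]_n, `|ip x ((M + k *: (u *m u^T)) *m x)| <= ip x x / 8 &
    (q + 2 * q ^+ 2) + (\tr (M + k *: (u *m u^T)) +
        2 * ip (M + k *: (u *m u^T)) (M + k *: (u *m u^T))) <=
    \tr (block_mx q%:M u^T u M) + 2 * ip (block_mx q%:M u^T u M : 'M[R]_(1 + n)) (block_mx q%:M u^T u M)].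
Proof.
move=> sM bnd.
have bnd' t (x : 'cV[R]_n) : `|q * t ^+ 2 + 2 * ip u x * t + ip x (M *m x)|
    <= (t ^+ 2 + ip x x) / 8.
  by have := bnd (col_mx t%:M x); rewrite ip_block_form ip_col_mx ip_scalar1.
have q8 : `|q| <= 8^-1.
  have := bnd' 1 0.
  by rewrite !mulmx0 !(ipC _ 0) !ip0l mulr0 mul0r !addr0 expr1n mulr1 mul1r.
have [q1 q2] : - 8^-1 <= q /\ q <= 8^-1 by move: q8; rewrite ler_norml => /andP.
have c0 : 0 < 1 - 2 * q by lra.
have k0 : 0 < k by rewrite divr_gt0.
have k1 : k <= 8 / 3 by rewrite ler_pdivrMr//; lra.
have Mform (x : 'cV[R]_n) : ip x ((M + k *: (u *m u^T)) *m x) = ip x (M *m x) + k * ip u x ^+ 2.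
  by rewrite mulmxDl ipDr -scalemxAl ipZr ip_outer.
have ub (x : 'cV[R]_n) : ip x (M *m x) + k * ip u x ^+ 2 <= ip x x / 8.
  have := bnd' (k * ip u x) x; rewrite ler_norml => /andP[_].
  have -> : q * (k * ip u x) ^+ 2 + 2 * ip u x * (k * ip u x) + ip x (M *m x) =
    (ip x (M *m x) + k * ip u x ^+ 2) + (q * k ^+ 2 + k) * ip u x ^+ 2 by ring.
  have -> : q * k ^+ 2 + k = k ^+ 2 / 2 by rewrite /k; field; rewrite gt_eqF.
  have := mulr_ge0 (sqr_ge0 k) (sqr_ge0 (ip u x)).
  have := ip_ge0 x; nra.
split=> //.
  move=> x; rewrite Mform ler_norml ub andbT.
  have := bnd' 0 x; rewrite expr0n /= !mulr0 !add0r ler_norml => /andP[+ _].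
  have := mulr_ge0 (ltW k0) (sqr_ge0 (ip u x)); lra.
rewrite ip_block mxtrace_block mxtrace_scalar /= mxtraceD mxtraceZ.
rewrite !ipDl !ipDr !ipZl !ipZr (ipC M).
have -> : \tr (u *m u^T) = ip u u by rewrite mxtrace_mulC.
have h N : ip (u *m u^T) N = ip u (N *m u).
  by rewrite /ip trmx_mul trmxK -mulmxA mxtrace_mulC -mulmxA.
rewrite !h ip_outer.
have := ub u; have := bnd' 0 u; rewrite expr0n /= !mulr0 !add0r ler_norml => /andP[_].
have := ip_ge0 u; set a := ip u u; set m := ip u _ => a0 m1 m2.
(* What remains to prove is k (a + 4 m + 2 k a^2) <= 4 a. Both m and m + k a^2 are at most a / 8,
   and k <= 8/3 makes the two sides match exactly. *)
have : k * (a + 2 * m + 2 * (m + k * a ^+ 2)) <= k * (a * (3 / 2)) by rewrite ler_pM2l//; lra.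
have : k * (a * (3 / 2)) <= 8 / 3 * (a * (3 / 2)) by rewrite ler_wpM2r//; lra.
rewrite mulr1n; nra.
Qed.

End gaussian_mgf.

Section gaussian_vector_mgf.
Set Implicit Arguments.
Unset Strict Implicit.
Context d (T : measurableType d) (R : realType) (P : probability T R).

Definition noise n (X : 'I_n -> {RV P >-> R}) (w : T) : 'cV[R]_n := \col_i X i w.

Lemma noiseS n (X : 'I_n.+1 -> {RV P >-> R}) w :
  noise X w = col_mx (X ord0 w)%:M (noise (fun i => X (lift ord0 i)) w)
    :> 'M[R]_(1 + n, 1).
Proof.
apply/colP => i; rewrite !mxE; case: splitP => j ij.
  by rewrite mxE (ord1 j) eqxx mulr1n; congr (X _ w); apply: val_inj; rewrite /= ij (ord1 j).
by rewrite mxE; congr (X _ w); apply: val_inj; rewrite /= ij.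
Qed.

Lemma isotropic_gaussian_tail n s (X : 'I_n.+1 -> {RV P >-> R}) :
  isotropic_gaussian s X -> isotropic_gaussian s (fun i => X (lift ord0 i)).
Proof.
move=> [ind law]; split; last by move=> i; exact: law.
move=> J B mB.
pose D (i : 'I_n.+1) := if unlift ord0 i is Some j then B j else setT.
have mD i : measurable (D i) by rewrite /D; case: unliftP.
have := @ind (lift ord0 @: J)%SET D mD.
rewrite big_imset /=; last by move=> i j _ _; exact: lift_inj.
under eq_bigr do rewrite /D liftK.
move=> <-; congr (P _); apply/seteqP; split => w /= h i /= iJ.
  by have /imsetP[j jJ ->] := iJ; rewrite /D liftK; exact: h.
have := h (lift ord0 i); rewrite /D liftK; apply => /=.
exact: imset_f.
Qed.

Section measurability.
Context d' (U : measurableType d').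

Lemma measurable_dotv n (u : 'cV[R]_n) (Y : 'I_n -> U -> R) :
  (forall i, measurable_fun setT (Y i)) ->
  measurable_fun setT (fun w => ip u (\col_i Y i w)).
Proof.
move=> mY; under eq_fun => w do rewrite ipE big_ord1.
apply: measurable_sum => i.
by under eq_fun => w do rewrite mxE; apply: measurable_funM.
Qed.

Lemma measurable_quadv n (M : 'M[R]_n) (Y : 'I_n -> U -> R) :
  (forall i, measurable_fun setT (Y i)) ->
  measurable_fun setT (fun w => ip (\col_i Y i w) (M *m \col_i Y i w)).
Proof.
move=> mY; under eq_fun => w do rewrite ipE big_ord1.
apply: measurable_sum => i.
under eq_fun => w do rewrite !mxE.
apply: measurable_funM => //; apply: measurable_sum => j.
by under eq_fun => w do rewrite mxE; apply: measurable_funM.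
Qed.

End measurability.

(** One step of the integration by coordinates: [b] and [c] depend on the tail only, so the inner
    integral is the one-dimensional [normal_quad_mgf]. *)
Lemma expectation_exp_head n s (X : 'I_n.+1 -> {RV P >-> R}) (q : R)
    (b c : T -> R) :
  0 < s -> isotropic_gaussian s X -> q < 2^-1 ->
  measurable_fun setT (b : tail_type X -> R) ->
  measurable_fun setT (c : tail_type X -> R) ->
  (\int[P]_w (expR ((q * X ord0 w ^+ 2 + b w * X ord0 w + c w) / s ^+ 2))%:E =
   ((Num.sqrt (1 - 2 * q))^-1)%:E *
   \int[P]_w (expR ((b w ^+ 2 / (2 * (1 - 2 * q)) + c w) / s ^+ 2))%:E)%E.
Proof.
move=> s0 [ind law] q2 mb mc.
pose F (z : tail_type X * R) : \bar R :=
  (expR ((q * z.2 ^+ 2 + b z.1 * z.2 + c z.1) / s ^+ 2))%:E.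
have mF : measurable_fun setT F.
  apply/measurable_EFinP; apply: measurableT_comp => //.
  apply: measurable_funM => //; apply: measurable_funD.
    apply: measurable_funD.
      by apply: measurable_funM => //; apply: measurable_funX.
    by apply: measurable_funM => //; exact: (measurableT_comp mb).
  exact: (measurableT_comp mc).
rewrite (integral_head_tail ind mF); last by move=> z; rewrite lee_fin expR_ge0.
have mq (b' c' : R) : measurable_fun setT (fun t : R =>
    (expR ((q * t ^+ 2 + b' * t + c') / s ^+ 2))%:E).
  apply/measurable_EFinP; apply: measurableT_comp => //.
  apply: measurable_funM => //; apply: measurable_funD => //.
  by apply: measurable_funD; apply: measurable_funM.
have inner w : (\int[distribution P (X ord0)]_t F (w, t) =
   ((Num.sqrt (1 - 2 * q))^-1)%:E * (expR ((b w ^+ 2 / (2 * (1 - 2 * q)) + c w) / s ^+ 2))%:E)%E.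
  rewrite (integral_gaussian_law (law ord0)).
  - rewrite /F /=.
    have E t : (expR ((q * t ^+ 2 + b w * t + c w) / s ^+ 2))%:E =
       ((expR (c w / s ^+ 2))%:E * (expR ((q * t ^+ 2 + b w * t) / s ^+ 2))%:E)%E.
      by rewrite -EFinM -expRD -mulrDl addrC.
    under eq_integral do rewrite E.
    rewrite ge0_integralZl//.
    + rewrite normal_quad_mgf// -!EFinM; congr EFin.
      rewrite mulrA -expRD mulrC; congr (_ * expR _).
      field.
      by rewrite !gt_eqF// subr_gt0 mulrC -ltr_pdivlMr// mul1r.
    + apply/measurable_EFinP; apply: measurableT_comp => //.
      by apply: measurable_funM => //; apply: measurable_funD; apply: measurable_funM.
  - exact: (mq (b w) (c w)).
  - by move=> t; rewrite lee_fin expR_ge0.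
under eq_integral do rewrite inner.
have mT (f : T -> R) : measurable_fun setT (f : tail_type X -> R) -> measurable_fun setT f.
  move=> mf _ B mB; have := @measurable_to_tail _ _ _ _ _ X measurableT _ (mf measurableT B mB).
  by rewrite !setTI.
rewrite ge0_integralZl//.
apply/measurable_EFinP; apply: measurableT_comp => //.
apply: measurable_funM => //; apply: measurable_funD; last exact: mT.
by apply: measurable_funM => //; apply: measurable_funX; exact: mT.
Qed.

(** Induction on the dimension. Integrating out the first coordinate leaves the form M + k u u^T,
    and [quad_elimination] transfers to it both the bound by 1/8 and the budget tr Q + 2 |Q|_F^2. *)
Lemma gaussian_quad_mgf n s (X : 'I_n -> {RV P >-> R}) (Q : 'M[R]_n) :
  0 < s -> isotropic_gaussian s X -> Q^T = Q ->
  (forall w : 'cV[R]_n, `|ip w (Q *m w)| <= ip w w / 8) ->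
  (\int[P]_w (expR (ip (noise X w) (Q *m noise X w) / s ^+ 2))%:E <=
   (expR (\tr Q + 2 * ip Q Q))%:E)%E.
Proof.
move=> s0; elim: n X Q => [|n IH] X Q gX sQ bQ.
  under eq_integral => w _.
    rewrite (_ : ip _ _ = 0); last by rewrite ipE big_ord1 big_ord0.
    rewrite mul0r expR0; over.
  rewrite integral_cst//= mul1e probability_setT lee_fin.
  by rewrite -[leLHS]expR0 ler_expR /mxtrace big_ord0 add0r mulr_ge0// ip_ge0.
have [q [u [M [sM QE]]]] := sym_blockP sQ; rewrite QE in bQ *.
have [q8 bM' fin] := quad_elimination sM bQ.
set M' := M + _ in bM' fin.
have q2 : q < 2^-1 by move: q8; rewrite ler_norml => /andP[_]; lra.
under eq_integral do rewrite noiseS ip_block_form.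
set Y := fun i => X (lift ord0 i).
rewrite expectation_exp_head//; last 2 first.
- apply: measurable_funM => //; apply: measurable_dotv => i; exact: measurable_tail.
- by apply: measurable_quadv => i; exact: measurable_tail.
apply: (@le_trans _ _ ((Num.sqrt (1 - 2 * q))^-1%:E * (expR (\tr M' + 2 * ip M' M'))%:E)%E).
  rewrite lee_wpmul2l// ?lee_fin ?invr_ge0//.
  have sM' : M'^T = M'.
    by rewrite /M' linearD /= linearZ /= trmx_mul trmxK sM.
  apply: le_trans (IH Y M' (isotropic_gaussian_tail gX) sM' bM').
  rewrite le_eqVlt; apply/orP; left; apply/eqP; apply: eq_integral => w _.
  have -> : ip (noise Y w) (M' *m noise Y w) = (2 * ip u (noise Y w)) ^+ 2 / (2 * (1 - 2 * q)) +
      ip (noise Y w) (M *m noise Y w).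
    rewrite /M' mulmxDl ipDr -scalemxAl ipZr ip_outer addrC; congr (_ + _).
    by field; rewrite gt_eqF// subr_gt0 mulrC -ltr_pdivlMr// mul1r.
  by [].
rewrite -EFinM lee_fin.
apply: (@le_trans _ _ (expR (q + 2 * q ^+ 2) * expR (\tr M' + 2 * ip M' M'))).
  by rewrite ler_wpM2r ?expR_ge0// inv_sqrt_le_expR.
by rewrite -expRD ler_expR.
Qed.

Lemma gaussian_linear_mgf n s (X : 'I_n -> {RV P >-> R}) (v : 'cV[R]_n) :
  0 < s -> isotropic_gaussian s X ->
  (\int[P]_w (expR (ip v (noise X w) / s))%:E = (expR (ip v v / 2))%:E)%E.
Proof.
move=> s0; elim: n X v => [|n IH] X v gX.
  under eq_integral => w _.
    rewrite (_ : ip _ _ = 0); last by rewrite ipE big_ord1 big_ord0.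
    rewrite mul0r expR0; over.
  rewrite integral_cst//= mul1e probability_setT.
  by rewrite ipE big_ord1 big_ord0 mul0r expR0.
pose v' : 'cV[R]_(1 + n) := v.
have [a [u vE]] : exists a (u : 'cV[R]_n), v' = col_mx a%:M u.
  by exists (usubmx v' 0 0), (dsubmx v'); rewrite -mx11_scalar vsubmxK.
have -> : ip v v = a * a + ip u u by rewrite -[v]/v' vE (@ip_col_mx _ 1 n) ip_scalar1.
pose Y i := X (lift ord0 i).
have hw w : ip v (noise X w) / s = (0 * X ord0 w ^+ 2 + (a * s) * X ord0 w +
    s * ip u (noise Y w)) / s ^+ 2.
  rewrite -[v]/v' vE noiseS (@ip_col_mx _ 1 n) ip_scalar1.
  by field; rewrite gt_eqF.
under eq_integral do rewrite hw.
rewrite expectation_exp_head//; last first.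
- apply: measurable_funM => //; apply: measurable_dotv => i; exact: measurable_tail.
rewrite mulr0 subr0 sqrtr1 invr1 mul1e mulr1.
have hw' w : (expR (((a * s) ^+ 2 / 2 + s * ip u (noise Y w)) / s ^+ 2))%:E =
    ((expR (a ^+ 2 / 2))%:E * (expR (ip u (noise Y w) / s))%:E)%E.
  by rewrite -EFinM -expRD; congr (expR _)%:E; field; rewrite gt_eqF.
under eq_integral do rewrite hw'.
rewrite ge0_integralZl//.
- by rewrite IH; [rewrite -EFinM -expRD -mulrDl expr2|exact: isotropic_gaussian_tail].
- apply/measurable_EFinP; apply: measurableT_comp => //.
  by apply: measurable_funM => //; exact: measurable_dotv.
Qed.

End gaussian_vector_mgf.

(** * Chaining *)

(** Tangent line at the midpoint: the two linear terms cancel. *)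
Lemma expR_midpoint {R : realType} (a b : R) :
  expR ((a + b) / 2) <= (expR a + expR b) / 2.
Proof.
have h (z : R) : 1 + z <= expR z := expR_ge1Dx z.
set m := (a + b) / 2.
have ha : expR a = expR m * expR (a - m) by rewrite -expRD addrC subrK.
have hb : expR b = expR m * expR (b - m) by rewrite -expRD addrC subrK.
rewrite ha hb -mulrDr -mulrA ler_peMr ?expR_ge0// ler_pdivlMr// mul1r.
by apply: le_trans (lerD (h _) (h _)); rewrite /m; lra.
Qed.

Section chaining.
Set Implicit Arguments.
Unset Strict Implicit.
Context d (T : measurableType d) (R : realType) (P : probability T R).

(** Suprema over index sets are replaced by a dominating function [G]; the three conditions are what
    sums and scalings of such functions preserve. *)
Definition integral_bound (G : T -> R) (B : R) : Prop :=
  [/\ measurable_fun setT G, forall w, 0 <= G w & (\int[P]_w (G w)%:E <= B%:E)%E].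

Lemma integral_boundD G H A B : integral_bound G A -> integral_bound H B ->
  integral_bound (fun w => G w + H w) (A + B).
Proof.
move=> [mG G0 GA] [mH H0 HB]; split.
- exact: measurable_funD.
- by move=> w; rewrite addr_ge0.
- under eq_integral do rewrite EFinD.
  rewrite ge0_integralD//; last 4 first.
  + by move=> w _; rewrite lee_fin.
  + exact/measurable_EFinP.
  + by move=> w _; rewrite lee_fin.
  + exact/measurable_EFinP.
  by rewrite EFinD leeD.
Qed.

Lemma integral_boundZ G A a : 0 <= a -> integral_bound G A ->
  integral_bound (fun w => a * G w) (a * A).
Proof.
move=> a0 [mG G0 GA]; split.
- exact: measurable_funM.
- by move=> w; rewrite mulr_ge0.
- under eq_integral do rewrite EFinM.
  rewrite ge0_integralZl//; last 2 first.
  + exact/measurable_EFinP.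
  + by move=> w _; rewrite lee_fin.
  by rewrite EFinM lee_wpmul2l.
Qed.

Lemma integral_bound_cst a : 0 <= a -> integral_bound (fun=> a) a.
Proof.
move=> a0; split => //.
by rewrite integral_cst//= probability_setT mule1.
Qed.

Lemma integral_bound_le G A B : A <= B -> integral_bound G A -> integral_bound G B.
Proof. by move=> AB [mG G0 GA]; split => //; apply: le_trans GA _; rewrite lee_fin. Qed.

Lemma integral_bound_sum (J : Type) (r : seq J) (Q : pred J) (G : J -> T -> R) (A : J -> R) :
  (forall j, integral_bound (G j) (A j)) ->
  integral_bound (fun w => \sum_(j <- r | Q j) G j w) (\sum_(j <- r | Q j) A j).
Proof.
move=> GA; elim: r => [|j r IH].
  rewrite big_nil; under eq_fun do rewrite big_nil; exact: integral_bound_cst.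
rewrite big_cons; under eq_fun do rewrite big_cons.
by case: (Q j) => //; exact: integral_boundD.
Qed.

Variables (I : finType) (V : I -> T -> R) (D : I -> R) (K c : R).
Hypothesis mV : forall k, measurable_fun setT (V k).
Hypothesis K0 : 0 <= K.
(** The first regime serves chaining, where t grows while distances shrink; the second serves the
    comparison with the reference point, at any distance but with small t. *)
Hypothesis Vmgf : forall k l t, t ^+ 2 * `|D k - D l| <= c ^+ 2 \/ `|t| <= c ->
  (\int[P]_w (expR (t * (V k w - V l w)))%:E <=
   (expR (K * (t ^+ 2 * `|D k - D l|)))%:E)%E.

Let Eb k l t B : (t ^+ 2 * `|D k - D l| <= c ^+ 2 \/ `|t| <= c) ->
  expR (K * (t ^+ 2 * `|D k - D l|)) <= B ->
  integral_bound (fun w => expR (t * (V k w - V l w))) B.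
Proof.
move=> h hB; split.
- apply: measurableT_comp => //; apply: measurable_funM => //; exact: measurable_funB.
- by move=> w; exact: expR_ge0.
- by apply: le_trans (Vmgf h) _; rewrite lee_fin.
Qed.

Let EbN k l t : t ^+ 2 * `|D k - D l| <= c ^+ 2 ->
  integral_bound (fun w => expR (t * (V k w - V l w)) + expR (- t * (V k w - V l w)))
    (2 * expR (K * c ^+ 2)).
Proof.
move=> h; rewrite mulr_natl mulr2n.
apply: integral_boundD; apply: Eb; rewrite ?sqrrN; try (by left);
  by rewrite ler_expR ler_wpM2l.
Qed.

Let expR_normr (x : R) : expR `|x| <= expR x + expR (- x).
Proof.
have [x0|x0] := ler0P x; [rewrite lerDr|rewrite lerDl]; exact: expR_ge0.
Qed.

(** Constant term of the recursion A' <= X + A / 2 obeyed by the bound on a block; its fixed point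
    is 2 X. *)
Let X := 2 * expR (K * c ^+ 2) + expR 4.

(* Jensen with weights 1/4, 1/2, 1/4 applied to 4x, 2y - 2 and 4; the factor
   e^-2 < 1/4 makes the recursion over the four quarters of a block contract. *)
Let expR_split (x y : R) :
  expR (x + y) <= 4^-1 * expR (4 * x) + 2^-1 * (expR (- 2) * expR (2 * y)) + 4^-1 * expR 4.
Proof.
rewrite -expRD.
have -> : x + y = ((4 * x + 4) / 2 + (- 2 + 2 * y)) / 2 by lra.
apply: le_trans (expR_midpoint _ _) _.
have := expR_midpoint (4 * x) 4; lra.
Qed.

(** Induction on the depth [N]. Depth 0 is a crude union bound over all of [I]. A block is cut into
    quarters, each with its own centre, and the pair (t, delta) becomes (2 t, delta / 4): t^2 delta
    is invariant, and the crude term is halved. The factor 16 in the hypothesis pays for the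
    exponent 4 t on the step from the old centre to the new one. *)
Lemma chaining_step N (S : {set I}) (m delta t : R) (b : I) :
  0 <= t -> 0 <= delta -> 16 * (t ^+ 2 * delta) <= c ^+ 2 ->
  (forall k, k \in S -> m <= D k <= m + delta) -> b \in S ->
  exists2 G, integral_bound G (2 * X + 2^-1 ^+ N * (#|I|%:R * (2 * expR (K * c ^+ 2)))) &
    forall w k, k \in S -> expR (t * `|V k w - V b w|) <= G w.
Proof.
elim: N S m delta t b => [|N IH] S m delta t b t0 d0 td SD bS.
  exists (fun w => \sum_(k in S) (expR (t * (V k w - V b w)) + expR (- t * (V k w - V b w)))).
    have h k : integral_bound (fun w => if k \in S then
          expR (t * (V k w - V b w)) + expR (- t * (V k w - V b w)) else 0)
        (2 * expR (K * c ^+ 2)).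
      case: (boolP (k \in S)) => [kS|_]; last first.
        by apply: integral_bound_le (integral_bound_cst (lexx 0)); rewrite mulr_ge0 ?expR_ge0.
      apply: EbN; apply: le_trans td.
      have : `|D k - D b| <= delta.
        by rewrite ler_norml; have /andP[? ?] := SD _ kS; have /andP[? ?] := SD _ bS; lra.
      have := sqr_ge0 t; have := normr_ge0 (D k - D b); nra.
    under eq_fun do rewrite big_mkcond.
    apply: integral_bound_le (integral_bound_sum (index_enum I) xpredT h).
    rewrite expr0 mul1r sumr_const -[_ *+ _]mulr_natl lerDr.
    by rewrite mulr_ge0// addr_ge0 ?mulr_ge0 ?expR_ge0.
  move=> w k kS; rewrite (bigD1 k)//= -[leLHS]addr0 lerD//.
    rewrite mulNr -[t in leLHS]ger0_norm// -normrM; exact: expR_normr.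
  by rewrite sumr_ge0// => j _; rewrite addr_ge0 ?expR_ge0.
set A := 2 * X + _ in IH.
pose lo (i : 'I_4) := m + i%:R * (delta / 4).
pose Sp (i : 'I_4) := [set k in S | lo i <= D k <= lo i + delta / 4]%SET.
have piece i : exists H, integral_bound H
      (2^-1 * expR (K * c ^+ 2) + 2^-1 * (expR (- 2) * A) + 4^-1 * expR 4) /\
    forall w k, k \in Sp i -> expR (t * `|V k w - V b w|) <= H w.
  have A0 : 0 <= A.
    by rewrite !(addr_ge0, mulr_ge0, expR_ge0, exprn_ge0, ler0n)// invr_ge0.
  have [E|[b' b'S]] := set_0Vmem (Sp i).
    exists (fun=> 0); split; last by move=> w k; rewrite E inE.
    apply: integral_bound_le (integral_bound_cst (lexx 0)).
    by rewrite !(addr_ge0, mulr_ge0, expR_ge0, invr_ge0).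
  have [||||G GA Gb] := IH (Sp i) (lo i) (delta / 4) (2 * t) b' _ _ _ _ b'S.
  - by rewrite mulr_ge0.
  - by rewrite divr_ge0.
  - by rewrite exprMn; apply: le_trans td; lra.
  - by move=> k; rewrite inE => /andP[].
  exists (fun w => 4^-1 * (expR ((4 * t) * (V b' w - V b w)) + expR (- (4 * t) * (V b' w - V b w))) +
     2^-1 * (expR (- 2) * G w) + 4^-1 * expR 4); split.
    apply: integral_boundD; last by apply: integral_bound_cst; rewrite mulr_ge0 ?expR_ge0.
    apply: integral_boundD; last first.
      by apply: integral_boundZ => //; apply: integral_boundZ => //; exact: expR_ge0.
    apply: (@integral_bound_le _ (4^-1 * (2 * expR (K * c ^+ 2)))); first by lra.
    apply: integral_boundZ => //; apply: EbN.
    move: b'S; rewrite inE => /andP[b'S _].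
    apply: le_trans td; rewrite exprMn.
    have : `|D b' - D b| <= delta.
      by rewrite ler_norml; have /andP[? ?] := SD _ b'S; have /andP[? ?] := SD _ bS; lra.
    have := sqr_ge0 t; have := normr_ge0 (D b' - D b); nra.
  move=> w k kS.
  apply: (@le_trans _ _ (expR (t * `|V b' w - V b w| + t * `|V k w - V b' w|))).
    rewrite ler_expR -mulrDr ler_wpM2l// [leRHS]addrC.
    exact: ler_distD.
  apply: le_trans (expR_split _ _) _.
  rewrite lerD2r lerD//.
    rewrite ler_wpM2l// mulrA -[4 * t in leLHS]ger0_norm ?mulr_ge0// -normrM mulNr.
    exact: expR_normr.
  rewrite ler_wpM2l// ler_wpM2l ?expR_ge0// mulrA; exact: Gb.
have /choice[H HP] := piece.
exists (fun w => \sum_(i : 'I_4) H i w).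
  apply: integral_bound_le (integral_bound_sum _ xpredT (fun i => (HP i).1)).
  rewrite sumr_const card_ord -[leLHS]mulr_natl.
  (* The four quarters add up to X + 2 e^-2 A, which e^-2 <= 1/4 brings below X + A / 2. *)
  have e2 : 4 <= expR 2 :> R.
    have := @expR_ge1Dx R 1; rewrite (_ : 2 = 1 + 1 :> R); last by lra.
    rewrite expRD; have := @expR_ge0 R 1; nra.
  have e2' : expR (- 2) <= 4^-1 :> R by rewrite expRN lef_pV2 ?posrE ?expR_gt0//.
  have A0 : 0 <= A.
    by rewrite !(addr_ge0, mulr_ge0, expR_ge0, exprn_ge0, ler0n)// invr_ge0.
  have := ler_wpM2r A0 e2'.
  rewrite [2^-1 ^+ N.+1]exprS -[2^-1 * _ * _]mulrA.
  have AE : A = 2 * X + 2^-1 ^+ N * (#|I|%:R * (2 * expR (K * c ^+ 2))) by [].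
  move: AE; rewrite /X; move: (2^-1 ^+ N * _) => y; lra.
move=> w k kS.
have [i ki] : exists i, k \in Sp i.
  have /andP[h1 h2] := SD _ kS.
  have [a1|a1] := leP (D k) (m + delta / 4).
    by exists ord0; rewrite inE kS /lo mul0r addr0 h1.
  have [a2|a2] := leP (D k) (m + 2 * (delta / 4)).
    by exists (inord 1); rewrite inE kS /lo inordK//; lra.
  have [a3|a3] := leP (D k) (m + 3 * (delta / 4)).
    by exists (inord 2); rewrite inE kS /lo inordK//; lra.
  by exists (inord 3); rewrite inE kS /lo inordK//; lra.
rewrite (bigD1 i)//= -[leLHS]addr0 lerD//; first exact: (HP i).2.
by rewrite sumr_ge0// => j _; have [[_ h _] _] := HP j.
Qed.

(** Depth |I| suffices to absorb the crude term, since |I| <= 2^|I|; the bound no longer depends on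
    the cardinality. *)
Lemma chaining (S : {set I}) (m delta t : R) (b : I) :
  0 <= t -> 0 <= delta -> 16 * (t ^+ 2 * delta) <= c ^+ 2 ->
  (forall k, k \in S -> m <= D k <= m + delta) -> b \in S ->
  exists2 G, integral_bound G (2 * X + 2 * expR (K * c ^+ 2)) &
    forall w k, k \in S -> expR (t * `|V k w - V b w|) <= G w.
Proof.
move=> t0 d0 td SD bS.
have [G GA Gb] := chaining_step #|I| t0 d0 td SD bS.
exists G => //; apply: integral_bound_le GA; rewrite lerD2l.
set e := 2 * expR _; have e0 : 0 <= e by rewrite mulr_ge0 ?expR_ge0.
rewrite [leLHS]mulrA ler_piMl// exprVn ler_pdivrMl ?exprn_gt0// mulr1.
by rewrite -natrX ler_nat ltnW// ltn_expl.
Qed.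

Lemma geometric_sum_le (r : R) N : 0 <= r < 1 -> \sum_(i < N) r ^+ i <= (1 - r)^-1.
Proof.
move=> /andP[r0 r1]; have c0 : 0 < 1 - r by lra.
rewrite -[leRHS]mul1r ler_pdivlMr// mulrC.
have := subrX1 r N; have := exprn_ge0 N r0; set y := \sum_(i < N) _ => ? ?; lra.
Qed.

(** With r = e^(-t/4), the drift contributes r^(2i) on the block i <= |D| <= i + 1 of either sign.
    Going from [o] to a point of the block costs e^((i+1)t/4), because 16 K t <= 1, and chaining
    inside the block costs [A]. A factor r^i is left, and the sum over the blocks is geometric. *)
Lemma peeling (o : I) (t : R) :
  0 < t -> 8 * t <= c -> 16 * (K * t) <= 1 -> c <= 1 -> D o = 0 ->
  exists2 G, integral_bound G
    (2 * ((1 - expR (- (t / 4)))^-1 * (expR (t / 4) + (2 * X + 2 * expR (K * c ^+ 2))))) &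
    forall w k, expR (t * (V k w - V o w - `|D k| / 2)) <= G w.
Proof.
move=> t0 tc tK c1 Do; set A := 2 * X + _.
have A0 : 0 <= A by rewrite !(addr_ge0, mulr_ge0, expR_ge0).
set r := expR (- (t / 4)).
have r0 : 0 <= r by exact: expR_ge0.
have r1 : r < 1 by rewrite expR_lt1; lra.
pose sg (s : bool) : R := if s then -1 else 1.
have block (s : bool) (i : nat) : exists H, integral_bound H (r ^+ i * (expR (t / 4) + A)) /\
    forall w k, i%:R <= sg s * D k <= i%:R + 1 -> expR (t * (V k w - V o w - `|D k| / 2)) <= H w.
  pose S := [set k | i%:R <= sg s * D k <= i%:R + 1]%SET.
  have B0 : 0 <= r ^+ i * (expR (t / 4) + A).
    by rewrite mulr_ge0 ?exprn_ge0// addr_ge0 ?expR_ge0.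
  have [E|[b bS]] := set_0Vmem S.
    exists (fun=> 0); split; first exact: integral_bound_le (integral_bound_cst (lexx 0)).
    move=> w k kS; have : k \in S by rewrite inE.
    by rewrite E inE.
  have Dabs k : k \in S -> i%:R <= `|D k| <= i%:R + 1.
    rewrite inE /sg => /andP[h1 h2]; have i0 : 0 <= i%:R :> R by [].
    by have [Dk|Dk] := ler0P (D k); case: (s) in h1 h2; lra.
  have [||||G GA Gb] := @chaining S (if s then - (i%:R + 1) else i%:R) 1 (2 * t) b _ _ _ _ bS.
  - by rewrite mulr_ge0// ltW.
  - by [].
  (* 16 (2 t)^2 = (8 t)^2, whence the assumption 8 t <= c. *)
  - by rewrite mulr1 exprMn; nra.
  - move=> k; rewrite inE /sg; case: (s); lra.
  exists (fun w => r ^+ i ^+ 2 * (expR (2 * t * (V b w - V o w)) + G w)); split.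
    have bS' := Dabs _ bS.
    apply: (@integral_bound_le _ (r ^+ i ^+ 2 * (expR (i%:R * (t / 4) + t / 4) + A))).
      rewrite expr2 -mulrA ler_wpM2l ?exprn_ge0 ?expR_ge0// mulrDr lerD//.
        by rewrite -expRM_natl -expRD ler_expR; lra.
      by rewrite ler_piMl// exprn_ile1// ltW.
    apply: integral_boundZ; first by rewrite !exprn_ge0 ?expR_ge0.
    apply: integral_boundD => //; apply: Eb; first by right; rewrite ger0_norm; lra.
    rewrite ler_expR Do subr0 exprMn.
    case/andP: bS' => b0 b1.
    have : K * t * (4 * (t * `|D b|)) <= 16^-1 * (4 * (t * `|D b|)).
      by rewrite ler_wpM2r//; [rewrite !mulr_ge0// ltW|lra].
    have : t * `|D b| <= t * (i%:R + 1) by rewrite ler_pM2l.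
    lra.
  move=> w k kS; have kS' : k \in S by rewrite inE.
  have /andP[k1 k2] := Dabs _ kS'.
  apply: (@le_trans _ _ (expR (- (i%:R * (t / 2))) * expR (t * (V b w - V o w) + t * `|V k w - V b w|))).
    rewrite -expRD ler_expR.
    have := ler_norm (V k w - V b w); set a := `|V k w - V b w|.
    set x := V k w; set y := V b w; set z := V o w => h.
    have := ler_wpM2l (ltW t0) h; have := ler_wpM2l (ltW t0) k1; lra.
  rewrite -exprM -expRM_natl natrM (_ : i%:R * 2 * - (t / 4) = - (i%:R * (t / 2))); last by lra.
  rewrite ler_wpM2l ?expR_ge0//.
  set a := t * (V b w - V o w).
  have := Gb w k kS'; rewrite -[2 * t * `|_|]mulrA; set a' := t * `|_|.
  rewrite -[2 * t * (_ - _)]mulrA -/a => Gw.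
  (* The sum a + a' is at most twice the larger term, so one of the two exponentials suffices. *)
  apply: (@le_trans _ _ (expR (2 * a) + expR (2 * a'))); last by rewrite lerD2l.
  have [aa|aa] := leP a a'.
    by rewrite -[leLHS]add0r lerD ?expR_ge0// ler_expR; lra.
  by rewrite -[leLHS]addr0 lerD ?expR_ge0// ler_expR; lra.
have /choice[H HP] := fun si : bool * nat => block si.1 si.2.
(* As [I] is finite, only finitely many blocks are occupied. *)
have [N hN] : exists N : nat, forall k, `|D k| < N%:R.
  pose M := \sum_k `|D k|.
  exists (Num.bound M) => k; apply: le_lt_trans (archi_boundP _); last by rewrite sumr_ge0.
  by rewrite /M (bigD1 k)//= lerDl sumr_ge0.
exists (fun w => \sum_(s : bool) \sum_(i < N) H (s, i : nat) w).
  have h s : integral_bound (fun w => \sum_(i < N) H (s, i : nat) w) ((1 - r)^-1 * (expR (t / 4) + A)).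
    apply: integral_bound_le (integral_bound_sum _ xpredT (fun i : 'I_N => (HP (s, i : nat)).1)).
    rewrite -mulr_suml; apply: ler_wpM2r; first by rewrite addr_ge0 ?expR_ge0.
    by apply: geometric_sum_le; rewrite r0.
  apply: integral_bound_le (integral_bound_sum _ xpredT h).
  by rewrite sumr_const card_bool -[leLHS]mulr_natl.
move=> w k.
have H0 si v : 0 <= H si v by have [[_ h _] _] := HP si.
pose s := D k < 0.
pose i := Num.truncn `|D k|.
have /andP[i1 i2] : i%:R <= `|D k| < i.+1%:R by apply: truncn_itv.
have iN : (i < N)%N by rewrite -(ltr_nat R); apply: le_lt_trans i1 (hN k).
rewrite (bigD1 s)//= (bigD1 (Ordinal iN))//= -addrA -[leLHS]addr0 lerD//.
  apply: (HP (s, i)).2 => /=.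
  have -> : sg s * D k = `|D k|.
    by rewrite /sg /s; case: ltP => d0; [rewrite ltr0_norm//; lra|rewrite ger0_norm//; lra].
  by rewrite i1 /=; apply/ltW; rewrite -natr1 in i2.
by rewrite addr_ge0// !sumr_ge0// => j _; rewrite sumr_ge0.
Qed.

End chaining.

(** * Ordered smoothers *)

Section ordered_smoothers.
Set Implicit Arguments.
Unset Strict Implicit.
Context {R : realType} {n M : nat}.
Variable A : 'I_M -> 'M[R]_n.
Hypothesis ordA : ordered_linear_smoothers A.

Lemma smoother_sym k : (A k)^T = A k.
Proof. by have [h _ _] := ordA; have [] := h k. Qed.

Lemma smoother_psd k : psd (A k).
Proof.
have [h _ _] := ordA; have [s b] := h k; split=> // w.
by have /andP[] := b w.
Qed.

Lemma smoother_psdC k : psd (1%:M - A k).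
Proof.
have [h _ _] := ordA; have [s b] := h k; split; first by rewrite linearB /= trmx1 s.
move=> w; rewrite qformE mulmxBl ipDr ipNr mul1mx -qformE subr_ge0.
by have /andP[_] := b w; rewrite enormE sqr_fnorm.
Qed.

Lemma smoother_comm k l : A k *m A l = A l *m A k.
Proof. by have [_ h _] := ordA. Qed.

Lemma smoother_total k l : loewner_le (A k) (A l) \/ loewner_le (A l) (A k).
Proof. by have [_ _ h] := ordA. Qed.

Lemma smoother_contract k p (X : 'M[R]_(n, p)) : fnorm (A k *m X) <= fnorm X.
Proof. exact: psd_contract (smoother_psd k) (smoother_psdC k). Qed.

Lemma smootherB_comm k l i j : (A k - A l) *m (A i - A j) = (A i - A j) *m (A k - A l).
Proof.
rewrite !(mulmxBl, mulmxBr) !(smoother_comm k) !(smoother_comm l).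
by rewrite !opprB; apply/matrixP => a b; rewrite !mxE; ring.
Qed.

(** The number of columns is free, so that [S] can be the data vector as well as the identity matrix
    extended by the scaled mean. *)
Definition sqdist p (S : 'M[R]_(n, p)) k l : R := ip ((A k - A l) *m S) ((A k - A l) *m S).

Lemma sqdistC p (S : 'M[R]_(n, p)) k l : sqdist S k l = sqdist S l k.
Proof. by rewrite /sqdist -opprB mulNmx ipNl ipNr opprK. Qed.

Lemma sqdist_ge0 p (S : 'M[R]_(n, p)) k l : 0 <= sqdist S k l.
Proof. exact: ip_ge0. Qed.

(** The cross term is <S, (A_c - A_b) (A_b - A_a) S>, nonnegative because the two factors are
    positive and commute. *)
Lemma sqdist_superadd p (S : 'M[R]_(n, p)) a b c :
  loewner_le (A a) (A b) -> loewner_le (A b) (A c) ->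
  sqdist S b a + sqdist S c b <= sqdist S c a.
Proof.
move=> ab bc; rewrite /sqdist.
have -> : (A c - A a) *m S = (A c - A b) *m S + (A b - A a) *m S.
  by rewrite -mulmxDl addrA subrK.
rewrite ipDl !ipDr (ipC ((A b - A a) *m S) ((A c - A b) *m S)).
suff : 0 <= ip ((A c - A b) *m S) ((A b - A a) *m S) by lra.
rewrite ip_mulA linearB /= !smoother_sym; apply: psd_mul_ip => //.
(* 1 - (A_c - A_b) = A_b + (1 - A_c). *)
- rewrite opprB addrCA; apply: psdD; [exact: smoother_psd|exact: smoother_psdC].
- exact: smootherB_comm.
Qed.

Lemma sqdist_parallelogram p (S : 'M[R]_(n, p)) a b c :
  sqdist S a c <= 2 * (sqdist S a b + sqdist S b c).
Proof.
rewrite /sqdist.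
have -> : (A a - A c) *m S = (A a - A b) *m S + (A b - A c) *m S.
  by rewrite -mulmxDl addrA subrK.
set x := _ *m S; set y := _ *m S.
have := ip_ge0 (x - y); rewrite !(ipDl, ipDr, ipNl, ipNr) (ipC y x); lra.
Qed.

Variable j : 'I_M.

Definition signed_sqdist p (S : 'M[R]_(n, p)) k : R :=
  if `[< loewner_le (A j) (A k) >] then sqdist S k j else - sqdist S k j.

Lemma norm_signed_sqdist p (S : 'M[R]_(n, p)) k : `|signed_sqdist S k| = sqdist S k j.
Proof.
by rewrite /signed_sqdist; case: ifP => _; rewrite ?normrN ger0_norm ?sqdist_ge0.
Qed.

Lemma signed_sqdist_ref p (S : 'M[R]_(n, p)) : signed_sqdist S j = 0.
Proof.
by apply/normr0_eq0; rewrite norm_signed_sqdist /sqdist subrr mul0mx ip0l.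
Qed.

(** On one side of [j] superadditivity bounds the distance by the difference; across [j] the signed
    difference is the sum of the two distances, and [sqdist_parallelogram] costs the factor 2. *)
Lemma sqdist_le_signed p (S : 'M[R]_(n, p)) k l :
  sqdist S k l <= 2 * `|signed_sqdist S k - signed_sqdist S l|.
Proof.
wlog kl : k l / loewner_le (A l) (A k).
  move=> h; have [] := smoother_total k l; last exact: h.
  by rewrite sqdistC distrC; exact: h.
have kl0 := sqdist_ge0 S k l; have k0 := sqdist_ge0 S k j; have l0 := sqdist_ge0 S l j.
rewrite /signed_sqdist; case: asboolP => jk; case: asboolP => jl.
- have := sqdist_superadd S jl kl => h; rewrite ger0_norm; lra.
- rewrite opprK ger0_norm ?addr_ge0//.
  by have := sqdist_parallelogram S k j l; rewrite (sqdistC S j l).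
(* Contradictory case: j below l and l below k put k above j. *)
- have jlk : loewner_le (A j) (A k).
    rewrite /loewner_le; have -> : A k - A j = (A k - A l) + (A l - A j) by rewrite addrA subrK.
    exact: psdD.
  by [].
- have kj : loewner_le (A k) (A j) by have [] := smoother_total k j.
  have := sqdist_superadd S kl kj.
  rewrite !(sqdistC S j) => h; rewrite ger0_norm; lra.
Qed.

(* With y = sigma (nu + g), Z_k / sigma^2 + D_k / 2 has linear part
   <lin_part k nu, g> and centred quadratic part given by quad_part k. *)
Definition lin_part k : 'M[R]_n := 2 *: (A k - A j) - (A k - A j) *m (A k - A j).
Definition quad_part k : 'M[R]_n := 2 *: (A k - A j) - 2^-1 *: ((A k - A j) *m (A k - A j)).

(** B^2 - C^2 = (B + C) (B - C) for commuting B and C; increments of the squares are thus controlled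
    by A_k - A_l alone. *)
Lemma sqr_incr k l p (X : 'M[R]_(n, p)) :
  (A k - A j) *m ((A k - A j) *m X) - (A l - A j) *m ((A l - A j) *m X) =
  (A k + A l - 2 *: A j) *m ((A k - A l) *m X).
Proof.
rewrite !mulmxA -mulmxBl; congr (_ *m X).
have -> : A k + A l - 2 *: A j = (A k - A j) + (A l - A j).
  by apply/matrixP => a b; rewrite !mxE; ring.
have E : A k - A l = (A k - A j) - (A l - A j) by rewrite opprB addrA subrK.
rewrite E; have := smootherB_comm k j l j.
move: (A k - A j) (A l - A j) => B C BC.
rewrite mulmxDl !mulmxBr BC.
by apply/matrixP => a b; rewrite !mxE; ring.
Qed.

(** 6 = 2 + (1 + 1 + 2): the linear term, then one contraction for each smoother in A_k + A_l - 2
    A_j. The halved square in [quad_part] turns this into 2 + 4/2 = 4. *)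
Lemma lin_incr_le k l p (X : 'M[R]_(n, p)) :
  fnorm ((lin_part k - lin_part l) *m X) <= 6 * fnorm ((A k - A l) *m X).
Proof.
set Y := (A k - A l) *m X.
have -> : (lin_part k - lin_part l) *m X = 2 *: Y - (A k *m Y + A l *m Y - 2 *: (A j *m Y)).
  rewrite scalemxAl -mulmxDl -mulmxBl -sqr_incr /lin_part /Y.
  have -> : A k - A l = (A k - A j) - (A l - A j) by rewrite opprB addrA subrK.
  move: (A k - A j) (A l - A j) => B C.
  rewrite !mulmxA -mulmxBl !scalemxAl -mulmxBl; congr (_ *m X).
  by apply/matrixP => a b; rewrite !mxE; ring.
have := smoother_contract k Y; have := smoother_contract l Y; have := smoother_contract j Y.
have := fnormB (2 *: Y) (A k *m Y + A l *m Y - 2 *: (A j *m Y)).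
have := fnormB (A k *m Y + A l *m Y) (2 *: (A j *m Y)).
have := fnormD (A k *m Y) (A l *m Y).
rewrite !fnormZ ger0_norm//; lra.
Qed.

Lemma quad_incr_le k l p (X : 'M[R]_(n, p)) :
  fnorm ((quad_part k - quad_part l) *m X) <= 4 * fnorm ((A k - A l) *m X).
Proof.
set Y := (A k - A l) *m X.
have -> : (quad_part k - quad_part l) *m X = 2 *: Y - 2^-1 *: (A k *m Y + A l *m Y - 2 *: (A j *m Y)).
  rewrite scalemxAl -mulmxDl -mulmxBl -sqr_incr /quad_part /Y.
  have -> : A k - A l = (A k - A j) - (A l - A j) by rewrite opprB addrA subrK.
  move: (A k - A j) (A l - A j) => B C.
  rewrite !mulmxA -mulmxBl; move: (B *m B) (C *m C) => BB CC.
  rewrite !scalemxAl -mulmxBl; congr (_ *m X).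
  by apply/matrixP => a b; rewrite !mxE; ring.
have := smoother_contract k Y; have := smoother_contract l Y; have := smoother_contract j Y.
have := fnormB (2 *: Y) (2^-1 *: (A k *m Y + A l *m Y - 2 *: (A j *m Y))).
have := fnormB (A k *m Y + A l *m Y) (2 *: (A j *m Y)).
have := fnormD (A k *m Y) (A l *m Y).
rewrite !fnormZ !ger0_norm ?invr_ge0//; lra.
Qed.

Lemma quad_part_sym k : (quad_part k)^T = quad_part k.
Proof.
have sB : (A k - A j)^T = A k - A j by rewrite linearB /= !smoother_sym.
by rewrite /quad_part linearB /= !linearZ /= trmx_mul sB.
Qed.

End ordered_smoothers.

(** * Deterministic regret inequality *)

Section q_aggregation.
Set Implicit Arguments.
Unset Strict Implicit.
Context {R : realType} {n M : nat}.
Variables (sigma : R) (A : 'I_M -> 'M[R]_n).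
Implicit Types (y mu : 'cV[R]_n) (theta : 'cV[R]_M).

Lemma Amix_mulmx theta y : Amix A theta *m y = \sum_k theta k 0 *: (A k *m y).
Proof. by rewrite /Amix mulmx_suml; apply: eq_bigr => k _; rewrite scalemxAl. Qed.

Definition vertex_cost y k : R :=
  2^-1 * ip (A k *m y) (A k *m y) - 2 * ip y (A k *m y) + 2 * sigma ^+ 2 * \tr (A k).

(** Variance identity: the theta-average of |(A_theta - A_k) y|^2 is that of |A_k y|^2 minus
    |A_theta y|^2. Half of it lowers the coefficient of |A_theta y|^2 from 1 to 1/2. *)
Lemma Qagg_criterionE y theta : simplex theta ->
  Qagg_criterion sigma A y theta =
  2^-1 * ip (Amix A theta *m y) (Amix A theta *m y) +
  \sum_k theta k 0 * vertex_cost y k + ip y y.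
Proof.
move=> [_ t1]; rewrite /Qagg_criterion /mallows_Cp enormE sqr_fnorm.
have trE : \tr (Amix A theta) = \sum_k theta k 0 * \tr (A k).
  by rewrite /Amix linear_sum /=; apply: eq_bigr => k _; rewrite mxtraceZ.
have pE : forall x : 'cV[R]_n, \sum_k theta k 0 * ip x (A k *m y) = ip x (Amix A theta *m y).
  by move=> x; rewrite Amix_mulmx ip_sumr; apply: eq_bigr => k _; rewrite ipZr.
rewrite trE; set p := Amix A theta *m y in pE *.
have -> : \sum_k theta k 0 * enorm ((Amix A theta - A k) *m y) ^+ 2 =
    \sum_k theta k 0 * ip (A k *m y) (A k *m y) - ip p p.
  transitivity (\sum_k (theta k 0 * ip p p - 2 * (theta k 0 * ip p (A k *m y)) +
      theta k 0 * ip (A k *m y) (A k *m y))).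
    apply: eq_bigr => k _; rewrite enormE sqr_fnorm mulmxBl -/p.
    rewrite !(ipDl, ipDr, ipNl, ipNr) (ipC (A k *m y) p); ring.
  rewrite big_split big_split /= sumrN -mulr_suml -mulr_sumr pE t1; ring.
have -> : \sum_k theta k 0 * vertex_cost y k =
    2^-1 * (\sum_k theta k 0 * ip (A k *m y) (A k *m y)) - 2 * ip y p +
    2 * sigma ^+ 2 * \sum_k theta k 0 * \tr (A k).
  rewrite -(pE y) !mulr_sumr -sumrN -!big_split /=; apply: eq_bigr => k _.
  rewrite /vertex_cost; ring.
rewrite !(ipDl, ipDr, ipNl, ipNr) (ipC y p); lra.
Qed.

Lemma simplex_segment theta theta' t : simplex theta -> simplex theta' ->
  0 <= t <= 1 -> simplex (theta + t *: (theta' - theta)).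
Proof.
move=> [h1 h2] [h1' h2'] /andP[t0 t1]; split.
  move=> k; rewrite !mxE; have := mulr_ge0 t0 (h1' k).
  have : 0 <= (1 - t) * theta k 0 by rewrite mulr_ge0//; lra.
  lra.
under eq_bigr do rewrite !mxE.
by rewrite big_split /= -mulr_sumr sumrB h2 h2' subrr mulr0 addr0.
Qed.

Lemma quadratic_slope_ge0 (a b : R) : 0 <= b ->
  (forall t, 0 <= t <= 1 -> 0 <= t * a + 2^-1 * t ^+ 2 * b) -> 0 <= a.
Proof.
move=> b0 h; rewrite leNgt; apply/negP => a0.
(* This t lies in (0, 1] and satisfies t b <= - a, so the quadratic term undoes at most half of the
   negative slope. *)
pose t := - a / (- a + b + 1).
have d0 : 0 < - a + b + 1 by lra.
have t0 : 0 < t by rewrite divr_gt0//; lra.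
have t1 : t <= 1 by rewrite ler_pdivrMr//; lra.
have := h t; rewrite (ltW t0) t1 => /(_ isT).
have -> : t * a + 2^-1 * t ^+ 2 * b = t * (a + 2^-1 * (t * b)) by ring.
rewrite pmulr_rge0//.
have : t * b <= - a.
  by rewrite /t mulrAC ler_pdivrMr// ler_wpM2l; lra.
lra.
Qed.

(** On the segment from [theta] to [theta'] the criterion is an exact quadratic polynomial.
    Minimality makes its slope at 0 nonnegative, so at the other end at least the quadratic term is
    gained. *)
Lemma argmin_strong_convexity y theta theta' :
  argmin (@simplex R M) (Qagg_criterion sigma A y) theta -> simplex theta' ->
  Qagg_criterion sigma A y theta +
    2^-1 * ip ((Amix A theta' - Amix A theta) *m y) ((Amix A theta' - Amix A theta) *m y)
  <= Qagg_criterion sigma A y theta'.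
Proof.
move=> [st opt] st'.
set q := (_ - _) *m y; set p := Amix A theta *m y.
have qE : Amix A theta' *m y = p + q by rewrite /q mulmxBl addrC subrK.
pose a := ip p q + (\sum_k theta' k 0 * vertex_cost y k - \sum_k theta k 0 * vertex_cost y k).
have HtE t : 0 <= t <= 1 ->
  Qagg_criterion sigma A y (theta + t *: (theta' - theta)) =
  Qagg_criterion sigma A y theta + (t * a + 2^-1 * t ^+ 2 * ip q q).
  move=> t01; rewrite !Qagg_criterionE//; last exact: simplex_segment.
  have -> : Amix A (theta + t *: (theta' - theta)) *m y = p + t *: q.
    rewrite /p /q mulmxBl !Amix_mulmx -sumrB scaler_sumr -big_split /=.
    by apply: eq_bigr => k _; rewrite !mxE scalerDl -scalerA scalerBl.
  have -> : \sum_k (theta + t *: (theta' - theta)) k 0 * vertex_cost y k =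
      \sum_k theta k 0 * vertex_cost y k +
      t * (\sum_k theta' k 0 * vertex_cost y k - \sum_k theta k 0 * vertex_cost y k).
    by rewrite -sumrB mulr_sumr -big_split /=; apply: eq_bigr => k _; rewrite !mxE; ring.
  rewrite -/p /a !(ipDl, ipDr, ipZl, ipZr) (ipC q p); lra.
have a0 : 0 <= a.
  apply: (@quadratic_slope_ge0 a (ip q q)); first exact: ip_ge0.
  move=> t t01; rewrite -(lerD2l (Qagg_criterion sigma A y theta)) addr0 -HtE//.
  by apply: opt; exact: simplex_segment.
have := HtE 1; rewrite scale1r addrC subrK ler01 lexx => /(_ isT) ->.
rewrite lerD2l expr1n; lra.
Qed.

Lemma simplex_vertex k : simplex (\col_i (i == k)%:R : 'cV[R]_M).
Proof.
split; first by move=> i; rewrite mxE ler0n.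
under eq_bigr do rewrite mxE.
by rewrite (bigD1 k)//= eqxx big1 ?addr0// => i /negbTE ->.
Qed.

Lemma sum_vertex (F : 'I_M -> R) k : \sum_i (\col_i (i == k)%:R : 'cV[R]_M) i 0 * F i = F k.
Proof.
rewrite (bigD1 k)//= mxE eqxx mul1r big1 ?addr0// => i /negbTE ik.
by rewrite mxE ik mul0r.
Qed.

Lemma Amix_vertex k : Amix A (\col_i (i == k)%:R) = A k.
Proof.
rewrite /Amix (bigD1 k)//= mxE eqxx scale1r big1 ?addr0// => i /negbTE ik.
by rewrite mxE ik scale0r.
Qed.

(** The half square in the criterion and the one gained by strong convexity at the vertex [j] add up
    to the |A_theta y|^2 of the loss; the other terms form a theta-average. *)
Lemma regret_decomposition y mu theta j :
  argmin (@simplex R M) (Qagg_criterion sigma A y) theta ->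
  enorm (Amix A theta *m y - mu) ^+ 2 - enorm (A j *m y - mu) ^+ 2 <=
  \sum_k theta k 0 * (2 * ip (y - mu) ((A k - A j) *m y) -
     2 * sigma ^+ 2 * \tr (A k - A j) - 2^-1 * sqdist A y k j).
Proof.
move=> opt; have [st _] := opt.
have := argmin_strong_convexity opt (simplex_vertex j).
rewrite !Qagg_criterionE//; last exact: simplex_vertex.
rewrite Amix_vertex sum_vertex !enormE !sqr_fnorm mulmxBl.
set p := Amix A theta *m y; set pj := A j *m y.
have pE : forall x : 'cV[R]_n, \sum_k theta k 0 * ip x (A k *m y) = ip x p.
  by move=> x; rewrite /p Amix_mulmx ip_sumr; apply: eq_bigr => k _; rewrite ipZr.
have [_ t1] := st.
have c1 (a : R) : \sum_k theta k 0 * a = a by rewrite -mulr_suml t1 mul1r.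
pose W := \sum_k theta k 0 * ip (A k *m y) (A k *m y).
pose Tr := \sum_k theta k 0 * \tr (A k).
have -> : \sum_k theta k 0 * vertex_cost y k = 2^-1 * W - 2 * ip y p + 2 * sigma ^+ 2 * Tr.
  rewrite -(pE y) /W /Tr !mulr_sumr -sumrN -!big_split /=; apply: eq_bigr => k _.
  rewrite /vertex_cost; ring.
have -> : \sum_k theta k 0 * (2 * ip (y - mu) ((A k - A j) *m y) -
     2 * sigma ^+ 2 * \tr (A k - A j) - 2^-1 * sqdist A y k j) =
   2 * (ip (y - mu) p - ip (y - mu) pj) - 2 * sigma ^+ 2 * (Tr - \tr (A j)) -
   2^-1 * (W - 2 * ip pj p + ip pj pj).
  rewrite (eq_bigr (fun k => 2 * (theta k 0 * ip (y - mu) (A k *m y)) +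
      (- 2) * (theta k 0 * ip (y - mu) pj) + (- (2 * sigma ^+ 2)) * (theta k 0 * \tr (A k)) +
      2 * sigma ^+ 2 * (theta k 0 * \tr (A j)) +
      (- 2^-1) * (theta k 0 * ip (A k *m y) (A k *m y)) +
      theta k 0 * ip pj (A k *m y) + (- 2^-1) * (theta k 0 * ip pj pj))).
    by rewrite !big_split /= -!mulr_sumr !c1 !pE -/W -/Tr; lra.
  move=> k _; rewrite /sqdist mulmxBl linearB /= -/pj !(ipDl, ipDr, ipNl, ipNr) (ipC (A k *m y) pj); lra.
rewrite /vertex_cost -/pj !(ipDl, ipDr, ipNl, ipNr) !(ipC _ mu) (ipC pj p); lra.
Qed.

End q_aggregation.

(** * Measurability of the aggregate *)

Section measurability_of_aggregate.
Set Implicit Arguments.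
Unset Strict Implicit.
Context {R : realType}.

Lemma fnorm_entry_le n (v : 'cV[R]_n) (e : R) : 0 <= e ->
  (forall i, `|v i 0| <= e) -> fnorm v <= n%:R * e.
Proof.
move=> e0 h; rewrite -(@ler_pXn2r _ 2)// ?nnegrE ?mulr_ge0 ?fnorm_ge0//.
rewrite sqr_fnorm ipE big_ord1 exprMn.
apply: (@le_trans _ _ (\sum_(i < n) e ^+ 2)).
  by apply: ler_sum => i _; rewrite -expr2 -real_normK ?num_real// ler_pXn2r// ?nnegrE.
rewrite sumr_const card_ord -[leLHS]mulr_natl ler_wpM2r ?sqr_ge0//.
by rewrite -natrX ler_nat -[leqLHS]expn1; case: (n) => // m; rewrite leq_pexp2l.
Qed.

(** The hypothesis makes [f] a continuous function of [X] on its range, so the preimage of an open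
    half-line is the union of the countably many rational boxes that it contains. *)
Lemma measurable_continuous_comp d (T : measurableType d) n (X : T -> 'cV[R]_n) (f : T -> R) :
  (forall i, measurable_fun setT (fun w => X w i 0)) ->
  (forall w e, 0 < e -> exists2 dl, 0 < dl &
     forall w', fnorm (X w' - X w) <= dl -> `|f w' - f w| < e) ->
  measurable_fun setT f.
Proof.
move=> mX cf; apply: (measurability _ (RGenOInfty.measurableE R)).
move=> _ [_ [c ->] <-]; rewrite setTI.
pose box (qk : {ffun 'I_n -> rat} * nat) : set T :=
  \bigcap_i [set w | `|X w i 0 - ratr (qk.1 i)| < qk.2.+1%:R^-1].
have mbox qk : measurable (box qk).
  apply: fin_bigcap_measurable => // i _.
  have mh : measurable_fun setT (fun w => `|X w i 0 - ratr (qk.1 i)|).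
    by apply: measurableT_comp => //; exact: measurable_funB.
  have := mh measurableT _ (measurable_itv `]-oo, (qk.2.+1%:R^-1 : R)[).
  rewrite setTI (_ : _ @^-1` _ = [set w | `|X w i 0 - ratr (qk.1 i)| < qk.2.+1%:R^-1]); last first.
    by apply/seteqP; split => w /=; rewrite in_itv.
  by [].
have -> : f @^-1` `]c, +oo[ =
    \bigcup_qk (if `[< box qk `<=` f @^-1` `]c, +oo[ >] then box qk else set0).
  apply/seteqP; split => [w fw|w [qk _]]; last first.
    by case: asboolP => // h; exact: h.
  have cfw : 0 < f w - c by rewrite subr_gt0; move: fw; rewrite /= in_itv/= andbT.
  have [dl dl0 hdl] := cf w _ cfw.
  (* Two points of a box of radius 1 / (k + 1) differ by at most 2 / (k + 1) in each entry, hence by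
     at most 2 n / (k + 1) <= dl in norm. *)
  pose k := Num.bound (2 * n%:R / dl).
  have approx (x u : R) : 0 < u -> exists q : rat, `|x - ratr q| < u.
    move=> u0; have /rat_in_itvoo[q] : x - u < x + u by lra.
    by rewrite in_itv/= => /andP[h1 h2]; exists q; rewrite ltr_norml; lra.
  have k0 : 0 < k.+1%:R^-1 :> R by rewrite invr_gt0.
  have /choice[q hq] := fun i => approx (X w i 0) _ k0.
  exists (finfun q, k) => //.
  rewrite asboolT; first by move=> i _ /=; rewrite ffunE.
  move=> w' hw'; rewrite /= in_itv/= andbT.
  suff : `|f w' - f w| < f w - c by rewrite ltr_norml => /andP[]; lra.
  apply: hdl.
  apply: (@le_trans _ _ (n%:R * (2 * k.+1%:R^-1))).
    apply: fnorm_entry_le => [|i]; first by rewrite mulr_ge0// ltW.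
    have := hw' i I; rewrite /= ffunE => h1; have := hq i => h2.
    rewrite !mxE (_ : X w' i 0 - X w i 0 =
      (X w' i 0 - ratr (q i)) - (X w i 0 - ratr (q i))); last by ring.
    apply: le_trans (ler_normB _ _) _; rewrite mulr_natl mulr2n.
    by rewrite lerD// ltW.
  have kb : 2 * n%:R / dl < k.+1%:R.
    apply: (@lt_trans _ _ k%:R); last by rewrite ltr_nat.
    by apply: archi_boundP; rewrite divr_ge0 ?mulr_ge0// ltW.
  rewrite mulrA [_ * 2]mulrC ler_pdivrMr//; apply/ltW.
  by rewrite [ltRHS]mulrC -ltr_pdivrMr.
apply: countable_bigcupT_measurable; first exact: countableP.
by move=> qk; case: asboolP.
Qed.

Context {n M : nat}.
Variables (sigma : R) (A : 'I_M -> 'M[R]_n).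
Hypothesis ordA : ordered_linear_smoothers A.

Lemma Amix_contract theta (x : 'cV[R]_n) : simplex theta ->
  fnorm (Amix A theta *m x) <= fnorm x.
Proof.
move=> [t0 t1]; rewrite Amix_mulmx.
apply: (@le_trans _ _ (\sum_k theta k 0 * fnorm x)); last by rewrite -mulr_suml t1 mul1r.
elim/big_ind2 : _ => [|a b a' b' h1 h2|k _].
- by rewrite /fnorm ip0l sqrtr0.
- exact: le_trans (fnormD _ _) (lerD h1 h2).
- by rewrite fnormZ ger0_norm// ler_wpM2l// (smoother_contract ordA).
Qed.

Lemma ip_sub_le (B : 'M[R]_n) (y y' : 'cV[R]_n) :
  (forall x : 'cV[R]_n, fnorm (B *m x) <= fnorm x) ->
  `|ip (B *m y) (B *m y) - ip (B *m y') (B *m y')| <=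
    fnorm (y' - y) * (fnorm y + fnorm y').
Proof.
move=> h; have -> : ip (B *m y) (B *m y) - ip (B *m y') (B *m y') =
    ip (B *m (y - y')) (B *m (y + y')).
  by rewrite mulmxBr mulmxDr !(ipDl, ipDr, ipNl, ipNr) (ipC (B *m y')); ring.
apply: le_trans (CauchySchwarz_ip _ _) _.
rewrite ler_pM ?fnorm_ge0//; first by rewrite -[leRHS]fnormN opprB; exact: h.
exact: le_trans (h _) (fnormD _ _).
Qed.

Lemma ip_smoother_sub_le k (y y' : 'cV[R]_n) :
  `|ip y (A k *m y) - ip y' (A k *m y')| <= fnorm (y' - y) * (fnorm y + fnorm y').
Proof.
have -> : ip y (A k *m y) - ip y' (A k *m y') = ip (A k *m (y - y')) (y + y').
  rewrite mulmxBr !(ipDl, ipDr, ipNl, ipNr) !(ipC _ y).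
  have sw (a b : 'cV[R]_n) : ip (A k *m a) b = ip (A k *m b) a.
    by rewrite ip_mulA (smoother_sym ordA) ipC.
  rewrite (ipC y (A k *m y')) (sw y y') (ipC (A k *m y') y'); ring.
apply: le_trans (CauchySchwarz_ip _ _) _.
rewrite ler_pM ?fnorm_ge0//; last exact: fnormD.
by rewrite -[leRHS]fnormN opprB; exact: smoother_contract.
Qed.

(** 4 = 1/2 + 5/2 + 1, one constant for each summand of [Qagg_criterionE]; the trace terms
    cancel. *)
Lemma Qagg_criterion_lipschitz theta (y y' : 'cV[R]_n) : simplex theta ->
  `|Qagg_criterion sigma A y theta - Qagg_criterion sigma A y' theta| <=
  4 * (fnorm (y' - y) * (fnorm y + fnorm y')).
Proof.
move=> st; have [t0 t1] := st; rewrite !Qagg_criterionE//.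
set e := fnorm (y' - y) * _.
have h1 : `|ip (Amix A theta *m y) (Amix A theta *m y) -
    ip (Amix A theta *m y') (Amix A theta *m y')| <= e.
  by apply: ip_sub_le => x; exact: Amix_contract.
have h2 : `|ip y y - ip y' y'| <= e.
  have := @ip_sub_le 1%:M y y'; rewrite !mul1mx; apply => x; by rewrite mul1mx.
have h3 : `|\sum_k theta k 0 * vertex_cost sigma A y k -
    \sum_k theta k 0 * vertex_cost sigma A y' k| <= (5 / 2) * e.
  rewrite -sumrB; apply: le_trans (ler_norm_sum _ _ _) _.
  apply: (@le_trans _ _ (\sum_k theta k 0 * (5 / 2 * e))); last by rewrite -mulr_suml t1 mul1r.
  apply: ler_sum => k _; rewrite -mulrBr normrM ger0_norm// ler_wpM2l//.
  have h4 := ip_sub_le y y' (fun x => smoother_contract ordA k x).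
  have h5 := ip_smoother_sub_le k y y'.
  move: h4 h5; rewrite -/e /vertex_cost !ler_norml; lra.
move: h1 h2 h3; rewrite !ler_norml; lra.
Qed.

(** Minimisers need not be unique, yet A_theta y is locally Hölder in y. Strong convexity at y,
    minimality at y' and two Lipschitz bounds give |q|^2 / 2 <= 8 |y' - y| (|y| + |y'|), where q =
    (A_theta' - A_theta) y. *)
Lemma aggregate_stability theta theta' (y y' : 'cV[R]_n) (p := Amix A theta *m y)
    (p' := Amix A theta' *m y') :
  argmin (@simplex R M) (Qagg_criterion sigma A y) theta ->
  argmin (@simplex R M) (Qagg_criterion sigma A y') theta' ->
  ip (p' - p) (p' - p) <= 2 * fnorm (y' - y) ^+ 2 + 32 * (fnorm (y' - y) * (fnorm y + fnorm y')).
Proof.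
move=> o o'; have [st opt] := o; have [st' opt'] := o'.
have h1 := argmin_strong_convexity o st'.
have h2 := opt' _ st.
have := Qagg_criterion_lipschitz y y' st; have := Qagg_criterion_lipschitz y y' st'.
rewrite !ler_norml => /andP[_ l1] /andP[l2 _].
move: h1; set q := (_ - _) *m y => h1.
have -> : p' - p = Amix A theta' *m (y' - y) + q.
  by rewrite /p /p' /q mulmxBr mulmxBl addrA subrK.
set b := Amix A theta' *m (y' - y).
have bq : ip (b + q) (b + q) <= 2 * ip b b + 2 * ip q q.
  have := ip_ge0 (b - q); rewrite !(ipDl, ipDr, ipNl, ipNr) (ipC q b); lra.
have bb : ip b b <= fnorm (y' - y) ^+ 2.
  by rewrite -sqr_fnorm ler_pXn2r// ?nnegrE ?fnorm_ge0//; exact: Amix_contract.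
lra.
Qed.

(** [theta] is an arbitrary selection of minimisers; by [aggregate_stability] the loss is
    nevertheless a continuous function of [y]. *)
Lemma measurable_aggregate_loss d (T : measurableType d) (y : T -> 'cV[R]_n)
    (theta : T -> 'cV[R]_M) (mu : 'cV[R]_n) :
  (forall i, measurable_fun setT (fun w => y w i 0)) ->
  (forall w, argmin (@simplex R M) (Qagg_criterion sigma A (y w)) (theta w)) ->
  measurable_fun setT (fun w => enorm (Amix A (theta w) *m y w - mu) ^+ 2).
Proof.
move=> my opt; apply: (measurable_continuous_comp my) => w e e0.
pose Y := fnorm (y w).
have Y0 : 0 <= Y by exact: fnorm_ge0.
(* For r <= 1, r [K1] bounds |p' - p|^2 and [K2] bounds |p' + p - 2 mu|. The 1 added in the
   denominator of [dl] keeps it positive and makes the last inequality strict. *)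
pose K1 := 2 + 32 * (2 * Y + 1).
pose K2 := 2 * Y + 1 + 2 * fnorm mu.
have m0 := fnorm_ge0 mu.
have K10 : 0 <= K1 by rewrite /K1; lra.
have K20 : 0 <= K2 by rewrite /K2; lra.
have KK0 : 0 <= K1 * K2 ^+ 2 by rewrite mulr_ge0 ?sqr_ge0.
pose dl := Num.min 1 (e ^+ 2 / (K1 * K2 ^+ 2 + 1)).
exists dl; first by rewrite lt_min ltr01 divr_gt0 ?exprn_gt0//; lra.
move=> w' wdl; set r := fnorm (y w' - y w) in wdl.
have r0 : 0 <= r by exact: fnorm_ge0.
have [r1 r2] : r <= 1 /\ r <= e ^+ 2 / (K1 * K2 ^+ 2 + 1).
  by move: wdl; rewrite le_min => /andP.
have Y' : fnorm (y w') <= Y + 1.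
  have := fnormD (y w' - y w) (y w); rewrite subrK -/r -/Y; lra.
set p := Amix A (theta w) *m y w; set p' := Amix A (theta w') *m y w'.
have stab := aggregate_stability (opt w) (opt w'); rewrite -/p -/p' -/r -/Y in stab.
have dp : ip (p' - p) (p' - p) <= r * K1.
  apply: le_trans stab _; rewrite /K1; nra.
rewrite !enormE !sqr_fnorm.
have -> : ip (p' - mu) (p' - mu) - ip (p - mu) (p - mu) = ip (p' - p) (p' + p - 2 *: mu).
  rewrite !(ipDl, ipDr, ipNl, ipNr, ipZr) (ipC mu) (ipC p p') (ipC mu p); ring.
apply: le_lt_trans (CauchySchwarz_ip _ _) _.
have pY : fnorm p <= Y by apply: Amix_contract; have [] := opt w.
have pY' : fnorm p' <= Y + 1.
  by apply: le_trans Y'; apply: Amix_contract; have [] := opt w'.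
have s2 : fnorm (p' + p - 2 *: mu) <= K2.
  apply: le_trans (fnormB _ _) _; rewrite fnormZ ger0_norm//.
  have := fnormD p' p; rewrite /K2; lra.
apply: (@le_lt_trans _ _ (fnorm (p' - p) * K2)).
  by rewrite ler_wpM2l ?fnorm_ge0.
rewrite -(@ltr_pXn2r _ 2)// ?nnegrE ?mulr_ge0 ?fnorm_ge0 ?(ltW e0)//.
rewrite exprMn sqr_fnorm.
apply: (@le_lt_trans _ _ (r * (K1 * K2 ^+ 2))).
  by rewrite mulrA ler_wpM2r ?sqr_ge0.
have D0 : 0 < K1 * K2 ^+ 2 + 1 by lra.
have : r * (K1 * K2 ^+ 2 + 1) <= e ^+ 2 by rewrite -ler_pdivlMr.
have e2 : 0 < e ^+ 2 by rewrite exprn_gt0.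
have [->|rn] := eqVneq r 0; first by rewrite !mul0r.
have : 0 < r by rewrite lt_neqAle eq_sym rn.
lra.
Qed.

End measurability_of_aggregate.

(** * The regret process *)

Section regret_process.
Set Implicit Arguments.
Unset Strict Implicit.
Context d (T : measurableType d) (R : realType) (P : probability T R) (n M : nat).
Variables (s : R) (eps : 'I_n -> {RV P >-> R}) (A : 'I_M -> 'M[R]_n) (j : 'I_M).
Variable nu : 'cV[R]_n.
Hypothesis s0 : 0 < s.
Hypothesis gauss : isotropic_gaussian s eps.
Hypothesis ordA : ordered_linear_smoothers A.

Let g (w : T) : 'cV[R]_n := s^-1 *: noise eps w.

Definition regret_process k (w : T) : R :=
  ip (lin_part A j k *m nu) (g w) +
  (ip (g w) (quad_part A j k *m g w) - \tr (quad_part A j k)).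

(** With this matrix [sqdist] is |A_k - A_l|_F^2 + |(A_k - A_l) nu|^2, the squared scale of the
    increments. *)
Let S : 'M[R]_(n, n + 1) := row_mx 1%:M nu.

Let sqdistE k l : sqdist A S k l =
  ip (A k - A l) (A k - A l) + ip ((A k - A l) *m nu) ((A k - A l) *m nu).
Proof.
by rewrite /sqdist mul_mx_row mulmx1 {1}/ip tr_row_mx mul_col_row mxtrace_block.
Qed.

Let measurable_noise i : measurable_fun setT (fun w => (g w) i 0).
Proof. by under eq_fun do rewrite !mxE; exact: measurable_funM. Qed.

Let gE w : g w = \col_i (g w) i 0.
Proof. by apply/colP => i; rewrite [RHS]mxE. Qed.

Lemma measurable_regret_process k : measurable_fun setT (regret_process k).
Proof.
rewrite /regret_process; under eq_fun do rewrite gE.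
apply: measurable_funD; first exact: measurable_dotv.
by apply: measurable_funB => //; exact: measurable_quadv.
Qed.

Let integral_lin_mgf (v : 'cV[R]_n) :
  (\int[P]_w (expR (ip v (g w)))%:E = (expR (ip v v / 2))%:E)%E.
Proof.
rewrite -(gaussian_linear_mgf v s0 gauss); apply: eq_integral => w _.
by rewrite /g ipZr mulrC.
Qed.

Let integral_quad_mgf (Q : 'M[R]_n) : Q^T = Q ->
  (forall w : 'cV[R]_n, `|ip w (Q *m w)| <= ip w w / 8) ->
  (\int[P]_w (expR (ip (g w) (Q *m g w)))%:E <= (expR (\tr Q + 2 * ip Q Q))%:E)%E.
Proof.
move=> sQ bQ; apply: le_trans (gaussian_quad_mgf s0 gauss sQ bQ).
rewrite le_eqVlt; apply/orP; left; apply/eqP; apply: eq_integral => w _.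
by rewrite /g -scalemxAr ipZl ipZr mulrA -invfM -expr2 mulrC.
Qed.

Let diff_le k l (w : 'cV[R]_n) : fnorm ((A k - A l) *m w) <= 2 * fnorm w.
Proof.
rewrite mulmxBl; apply: le_trans (fnormB _ _) _.
have := smoother_contract ordA k w; have := smoother_contract ordA l w; lra.
Qed.

(** Brings 2 t Q into the range of [gaussian_quad_mgf]. For small t the operator norm of A_k - A_l
    is bounded by 2; otherwise it is bounded by the Frobenius norm, whose square is at most 2 |D_k -
    D_l|. *)
Let quad_form_le k l t (w : 'cV[R]_n) (Q := quad_part A j k - quad_part A j l) :
  t ^+ 2 * `|signed_sqdist A j S k - signed_sqdist A j S l| <= 128^-1 ^+ 2 \/ `|t| <= 128^-1 ->
  `|ip w (((2 * t) *: Q) *m w)| <= ip w w / 8.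
Proof.
move=> h; rewrite -scalemxAl ipZr !normrM (ger0_norm (_ : 0 <= 2))//.
have h1 : `|ip w (Q *m w)| <= fnorm w * (4 * fnorm ((A k - A l) *m w)).
  apply: le_trans (CauchySchwarz_ip _ _) _.
  by rewrite ler_wpM2l ?fnorm_ge0//; exact: quad_incr_le.
suff h2 : `|t| * fnorm ((A k - A l) *m w) <= 64^-1 * fnorm w.
  rewrite -[ip w w]sqr_fnorm; have := ler_wpM2l (normr_ge0 t) h1.
  have := ler_wpM2l (fnorm_ge0 w) h2; lra.
have w0 := fnorm_ge0 w; have t0 := normr_ge0 t.
case: h => h; last first.
  apply: (@le_trans _ _ (128^-1 * (2 * fnorm w))); last by lra.
  by rewrite ler_pM ?fnorm_ge0//; exact: diff_le.
apply: (@le_trans _ _ (`|t| * (fnorm (A k - A l) * fnorm w))).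
  by rewrite ler_wpM2l//; exact: fnorm_mulmx_le.
rewrite mulrA ler_wpM2r//.
rewrite -(@ler_pXn2r _ 2)// ?nnegrE ?mulr_ge0 ?fnorm_ge0// exprMn real_normK ?num_real// sqr_fnorm.
have := sqdist_le_signed ordA j S k l; rewrite sqdistE.
have := ip_ge0 ((A k - A l) *m nu); have := sqr_ge0 t.
set a := ip _ _; set b := ip _ _; set D := `|_ - _| in h *; nra.
Qed.

(** Midpoint convexity separates the linear from the quadratic part at the price of doubling t, and
    the trace cancels the mean of the latter. The linear part needs the constant 144, the quadratic
    part 2 * 4 * 16 * 2 = 256. *)
Lemma regret_process_mgf k l t :
  t ^+ 2 * `|signed_sqdist A j S k - signed_sqdist A j S l| <= 128^-1 ^+ 2 \/ `|t| <= 128^-1 ->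
  (\int[P]_w (expR (t * (regret_process k w - regret_process l w)))%:E <=
   (expR (256 * (t ^+ 2 * `|signed_sqdist A j S k - signed_sqdist A j S l|)))%:E)%E.
Proof.
move=> h; pose L := (lin_part A j k - lin_part A j l) *m nu.
pose Q := quad_part A j k - quad_part A j l.
have sQ : ((2 * t) *: Q)^T = (2 * t) *: Q.
  by rewrite linearZ /= /Q linearB /= !(quad_part_sym ordA).
have dom w : expR (t * (regret_process k w - regret_process l w)) <=
    2^-1 * expR (ip ((2 * t) *: L) (g w)) +
    2^-1 * (expR (- \tr ((2 * t) *: Q)) * expR (ip (g w) (((2 * t) *: Q) *m g w))).
  rewrite -expRD.
  have -> : t * (regret_process k w - regret_process l w) =
    (ip ((2 * t) *: L) (g w) + (- \tr ((2 * t) *: Q) + ip (g w) (((2 * t) *: Q) *m g w))) / 2.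
    rewrite /regret_process; move: (g w) => h'.
    rewrite /L /Q -scalemxAl !mulmxBl ipZl ipZr mxtraceZ.
    rewrite linearB /= !(ipDl, ipDr, ipNl, ipNr); lra.
  by apply: le_trans (expR_midpoint _ _) _; lra.
have mg : measurable_fun setT (fun w => expR (ip ((2 * t) *: L) (g w))).
  by apply: measurableT_comp => //; under eq_fun do rewrite gE; exact: measurable_dotv.
have mq : measurable_fun setT (fun w => expR (ip (g w) (((2 * t) *: Q) *m g w))).
  by apply: measurableT_comp => //; under eq_fun do rewrite gE; exact: measurable_quadv.
have B1 : integral_bound P (fun w => expR (ip ((2 * t) *: L) (g w)))
    (expR (ip ((2 * t) *: L) ((2 * t) *: L) / 2)).
  by split => [//|w|]; [exact: expR_ge0|rewrite integral_lin_mgf].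
have B2 : integral_bound P (fun w => expR (ip (g w) (((2 * t) *: Q) *m g w)))
    (expR (\tr ((2 * t) *: Q) + 2 * ip ((2 * t) *: Q) ((2 * t) *: Q))).
  split => [//|w|]; first exact: expR_ge0.
  by apply: integral_quad_mgf => // w; exact: quad_form_le.
have h2 : 0 <= 2^-1 :> R by [].
have [mG _ BG] := integral_boundD (integral_boundZ h2 B1)
  (integral_boundZ h2 (integral_boundZ (expR_ge0 (- \tr ((2 * t) *: Q))) B2)).
apply: le_trans (le_trans _ BG) _.
  apply: ge0_le_integral => //.
  - apply/measurable_EFinP; apply: measurableT_comp => //; apply: measurable_funM => //.
    by apply: measurable_funB; exact: measurable_regret_process.
  - exact/measurable_EFinP.
  - by move=> w ?; rewrite lee_fin.
rewrite lee_fin -expRD addrA addNr add0r.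
set D := `|_ - _| in h *.
have sq := sqdist_le_signed ordA j S k l; rewrite sqdistE -/D in sq.
have q1 : ip ((2 * t) *: L) ((2 * t) *: L) / 2 <= 256 * (t ^+ 2 * D).
  rewrite ipZl ipZr.
  have : ip L L <= 36 * ip ((A k - A l) *m nu) ((A k - A l) *m nu).
    have := lin_incr_le ordA j k l nu; rewrite -/L.
    rewrite -(@ler_pXn2r _ 2)// ?nnegrE ?mulr_ge0 ?fnorm_ge0// exprMn !sqr_fnorm; lra.
  have := ip_ge0 (A k - A l); have := ip_ge0 ((A k - A l) *m nu).
  set a := ip L L; set b := ip _ _ in sq *; set c := ip _ _ in sq * => b0 c0 ac.
  have : t ^+ 2 * a <= t ^+ 2 * (36 * (2 * D)) by rewrite ler_wpM2l ?sqr_ge0//; lra.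
  have : 0 <= t ^+ 2 * D by rewrite mulr_ge0 ?sqr_ge0 ?normr_ge0.
  lra.
have q2 : 2 * ip ((2 * t) *: Q) ((2 * t) *: Q) <= 256 * (t ^+ 2 * D).
  rewrite ipZl ipZr.
  have : ip Q Q <= 16 * ip (A k - A l) (A k - A l).
    have := quad_incr_le ordA j k l (1%:M : 'M[R]_n); rewrite -/Q !mulmx1.
    rewrite -(@ler_pXn2r _ 2)// ?nnegrE ?mulr_ge0 ?fnorm_ge0// exprMn !sqr_fnorm; lra.
  have := ip_ge0 ((A k - A l) *m nu); have := ip_ge0 (A k - A l).
  set a := ip Q Q; set b := ip _ _ in sq *; set c := ip _ _ in sq * => b0 c0 ac.
  have : t ^+ 2 * a <= t ^+ 2 * (16 * (2 * D)) by rewrite ler_wpM2l ?sqr_ge0//; lra.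
  have : 0 <= t ^+ 2 * D by rewrite mulr_ge0 ?sqr_ge0 ?normr_ge0.
  lra.
have := ler_expR (ip ((2 * t) *: L) ((2 * t) *: L) / 2) (256 * (t ^+ 2 * D)).
have := ler_expR (2 * ip ((2 * t) *: Q) ((2 * t) *: Q)) (256 * (t ^+ 2 * D)).
rewrite q1 q2 => e2 e1; lra.
Qed.

Lemma regret_process_ref w : regret_process j w = 0.
Proof.
rewrite /regret_process /lin_part /quad_part !subrr !mulmx0 !scaler0 !subr0.
by rewrite !mul0mx mxtrace0 ip0l ipC ip0l subr0 addr0.
Qed.

(** With K = 256, the exponent t = 64^-2 is the largest for which 16 K t <= 1. *)
Lemma regret_process_peeling (t : R := 64^-1 ^+ 2) (c : R := 128^-1) (K : R := 256) :
  exists2 G, integral_bound P G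
    (2 * ((1 - expR (- (t / 4)))^-1 * (expR (t / 4) +
      (2 * (2 * expR (K * c ^+ 2) + expR 4) + 2 * expR (K * c ^+ 2))))) &
    forall w k, expR (t * (regret_process k w - sqdist A S k j / 2)) <= G w.
Proof.
have [|||||||G GA Gb] := @peeling _ _ _ P _ regret_process (signed_sqdist A j S) K c
  measurable_regret_process _ _ j t.
- by [].
- by move=> k l u; exact: regret_process_mgf.
- by rewrite exprn_gt0// invr_gt0.
- by rewrite /t /c; lra.
- by rewrite /K /t; lra.
- by rewrite /c; lra.
- exact: signed_sqdist_ref.
exists G => // w k; have := Gb w k.
by rewrite regret_process_ref subr0 norm_signed_sqdist.
Qed.

Lemma regret_processE k w (y := s *: nu + noise eps w) :
  2 * ip (noise eps w) ((A k - A j) *m y) - 2 * s ^+ 2 * \tr (A k - A j) -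
    2^-1 * sqdist A y k j =
  s ^+ 2 * (regret_process k w - sqdist A S k j / 2).
Proof.
rewrite sqdistE /sqdist /regret_process /lin_part /quad_part.
have sB : (A k - A j)^T = A k - A j by rewrite linearB /= !(smoother_sym ordA).
move: (A k - A j) sB => B sB.
have nE : noise eps w = s *: g w by rewrite /g scalerA divff ?gt_eqF// scale1r.
rewrite /y nE -scalerDr; move: (g w) => h.
have sw (a b : 'cV[R]_n) : ip (B *m a) b = ip a (B *m b) by rewrite ip_mulA sB.
rewrite !mulmxBl -!scalemxAl -!mulmxA -!scalemxAr mulmxDr.
rewrite linearB /= !mxtraceZ [\tr (B *m B)](_ : _ = ip B B); last by rewrite /ip sB.
rewrite !(ipDl, ipDr, ipNl, ipNr, ipZl, ipZr) !sw.
have -> : ip nu (B *m h) = ip h (B *m nu) by rewrite -sw ipC.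
have -> : ip nu (B *m (B *m h)) = ip h (B *m (B *m nu)) by rewrite -[LHS]sw -[LHS]sw ipC.
lra.
Qed.

End regret_process.

(** * Expectation and deviation bounds for the regret *)

Definition regret_constant (R : realType) : R :=
  2 * ((1 - expR (- (64^-1 ^+ 2 / 4)))^-1 * (expR (64^-1 ^+ 2 / 4) +
    (2 * (2 * expR (256 * 128^-1 ^+ 2) + expR 4) + 2 * expR (256 * 128^-1 ^+ 2)))).

Lemma regret_constant_gt0 (R : realType) : 0 < regret_constant R.
Proof.
have t0 : 0 < 64^-1 ^+ 2 / 4 :> R by rewrite divr_gt0// exprn_gt0// invr_gt0.
rewrite /regret_constant; move: (64^-1 ^+ 2 / 4) (256 * _) t0 => t k t0.
rewrite pmulr_rgt0// pmulr_rgt0.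
  have k0 := expR_gt0 k; have e4 := expR_gt0 (4 : R); have et := expR_gt0 t; lra.
by rewrite invr_gt0 subr_gt0 expR_lt1 oppr_lt0.
Qed.

Section regret_bound.
Set Implicit Arguments.
Unset Strict Implicit.
Context d (T : measurableType d) (R : realType) (P : probability T R) (n M : nat).
Variables (s : R) (mu : 'cV[R]_n) (eps : 'I_n -> {RV P >-> R}) (y : T -> 'cV[R]_n).
Variables (A : 'I_M -> 'M[R]_n) (theta : T -> 'cV[R]_M).
Hypothesis s0 : 0 < s.
Hypothesis gauss : isotropic_gaussian s eps.
Hypothesis yE : forall w, y w = mu + \col_i eps i w.
Hypothesis ordA : ordered_linear_smoothers A.
Hypothesis opt : forall w,
  argmin (@simplex R M) (Qagg_criterion s A (y w)) (theta w).

Let loss (B : 'M[R]_n) (w : T) : R := enorm (B *m y w - mu) ^+ 2.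
Let agg_loss (w : T) : R := loss (Amix A (theta w)) w.

(** In logarithmic form [G] bounds all the Z_k at once, hence also their average with the
    data-dependent weights [theta]. *)
Lemma regret_dominated j : exists2 G, integral_bound P G (regret_constant R) &
  forall w, expR (64^-1 ^+ 2 * ((agg_loss w - loss (A j) w) / s ^+ 2)) <= G w.
Proof.
have [G GA Gb] := regret_process_peeling j (s^-1 *: mu) s0 gauss ordA.
exists G => // w; set t : R := 64^-1 ^+ 2 in Gb *.
have G0 : 0 < G w by apply: lt_le_trans (Gb w j); exact: expR_gt0.
have t0 : 0 < t by rewrite exprn_gt0// invr_gt0.
have s2 : 0 < s ^+ 2 by rewrite exprn_gt0.
have [[th0 th1] _] := opt w.
rewrite -[leRHS](lnK (_ : G w \is Num.pos))// ler_expR mulrC -ler_pdivlMr//.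
rewrite ler_pdivrMr// mulrC.
apply: le_trans (regret_decomposition _ _ (opt w)) _.
rewrite -[leRHS]mul1r -[X in _ <= X * _]th1 mulr_suml; apply: ler_sum => k _.
rewrite ler_wpM2l//.
have yE' : y w = s *: (s^-1 *: mu) + noise eps w.
  by rewrite yE scalerA divff ?gt_eqF// scale1r.
have nE : y w - mu = noise eps w by rewrite yE addrC addKr.
rewrite nE yE' regret_processE// ler_pM2l// ler_pdivlMr// mulrC.
by rewrite -ler_expR lnK.
Qed.

Lemma measurable_data i : measurable_fun setT (fun w => y w i 0).
Proof.
have -> : (fun w => y w i 0) = (fun w => mu i 0 + eps i w).
  by apply/funext => w; rewrite yE !mxE.
exact: measurable_funD.
Qed.

Lemma measurable_agg_loss : measurable_fun setT agg_loss.
Proof. exact: (measurable_aggregate_loss ordA mu measurable_data opt). Qed.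

Lemma measurable_loss (B : 'M[R]_n) : measurable_fun setT (loss B).
Proof.
rewrite /loss; under eq_fun do rewrite enormE sqr_fnorm ipE big_ord1.
apply: measurable_sum => i.
have h : measurable_fun setT (fun w => (B *m y w - mu) i 0).
  under eq_fun do rewrite !mxE.
  apply: measurable_funB => //; apply: measurable_sum => k.
  by apply: measurable_funM => //; exact: measurable_data.
exact: measurable_funM.
Qed.

(** Integrates u <= e^u <= G for u = 64^-2 times the regret over s^2. The additive form is
    meaningful in the extended reals without finiteness of the risks. *)
Lemma expected_regret_le j :
  ('E_P[agg_loss] <= (64 ^+ 2 * regret_constant R * s ^+ 2)%:E + 'E_P[loss (A j)])%E.
Proof.
have [G [mG G0 GA] Gb] := regret_dominated j.
have s2 : 0 < s ^+ 2 by rewrite exprn_gt0.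
have t0 : 0 < 64^-1 ^+ 2 :> R by rewrite exprn_gt0// invr_gt0.
rewrite unlock.
have c0 : 0 <= 64 ^+ 2 * s ^+ 2 by rewrite mulr_ge0 ?sqr_ge0// exprn_ge0.
apply: (@le_trans _ _ (\int[P]_w ((64 ^+ 2 * s ^+ 2)%:E * (G w)%:E + (loss (A j) w)%:E))%E).
  apply: ge0_le_integral => //.
  - by move=> w _; rewrite lee_fin sqr_ge0.
  - by apply/measurable_EFinP; exact: measurable_agg_loss.
  - apply: emeasurable_funD; last by apply/measurable_EFinP; exact: measurable_loss.
    by apply: emeasurable_funM => //; exact/measurable_EFinP.
  - move=> w _; rewrite -EFinM -EFinD lee_fin -lerBlDr.
    have := le_trans (le_trans _ (expR_ge1Dx _)) (Gb w).
    set r := agg_loss w - _ => h.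
    have {}h : 64^-1 ^+ 2 * (r / s ^+ 2) <= G w by apply: h; rewrite lerDr.
    have -> : r = 64 ^+ 2 * s ^+ 2 * (64^-1 ^+ 2 * (r / s ^+ 2)) by field; rewrite gt_eqF.
    by rewrite ler_wpM2l.
rewrite ge0_integralD//; last 4 first.
- by move=> w _; rewrite mule_ge0 ?lee_fin.
- by apply: emeasurable_funM => //; exact/measurable_EFinP.
- by move=> w _; rewrite lee_fin sqr_ge0.
- by apply/measurable_EFinP; exact: measurable_loss.
rewrite leeD2r// ge0_integralZl//; last 2 first.
- exact/measurable_EFinP.
- by move=> w _; rewrite lee_fin.
by rewrite [in leRHS]mulrAC [leRHS]EFinM lee_wpmul2l.
Qed.

(** Chernoff bound: on the complementary event e^(-x) G is at least 1. *)
Lemma regret_tail j x :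
  ((1 - regret_constant R * expR (- x))%:E <=
   P [set w | (agg_loss w - loss (A j) w <= 64 ^+ 2 * s ^+ 2 * x)%R])%E.
Proof.
have [G [mG G0 GA] Gb] := regret_dominated j.
have s2 : 0 < s ^+ 2 by rewrite exprn_gt0.
set E := [set w | _].
have mE : measurable E.
  have mf : measurable_fun setT (fun w => agg_loss w - loss (A j) w).
    by apply: measurable_funB; [exact: measurable_agg_loss|exact: measurable_loss].
  have := mf measurableT _ (measurable_itv `]-oo, 64 ^+ 2 * s ^+ 2 * x]).
  rewrite setTI (_ : _ @^-1` _ = E); first by [].
  by apply/seteqP; split => w; rewrite /E /= in_itv.
have PC : (P (~` E) <= (regret_constant R * expR (- x))%:E)%E.
  have mC : measurable (~` E) by exact: measurableC.
  have -> : P (~` E) = (\int[P]_w (\1_(~` E) w)%:E)%E by rewrite integral_indic// setIT.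
  apply: (@le_trans _ _ (\int[P]_w ((expR (- x))%:E * (G w)%:E))%E).
    apply: ge0_le_integral => //.
    + by apply/measurable_EFinP; exact: measurable_indic.
    + by apply: emeasurable_funM => //; exact/measurable_EFinP.
    + move=> w _; rewrite -EFinM lee_fin indicE; have [|nE] := boolP (w \in ~` E); last first.
        by rewrite mulr_ge0 ?expR_ge0.
      rewrite inE /E /= => /negP; rewrite -ltNge => wE.
      rewrite -[leLHS](expR0 R) -(addNr x) expRD ler_wpM2l ?expR_ge0//.
      apply: le_trans (Gb w); rewrite ler_expR.
      set r := agg_loss w - _ in wE *.
      have -> : x = 64^-1 ^+ 2 * (64 ^+ 2 * s ^+ 2 * x / s ^+ 2) by field; rewrite gt_eqF.
      by rewrite ler_wpM2l ?exprn_ge0 ?invr_ge0// ler_pM2r ?invr_gt0// ltW.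
  rewrite ge0_integralZl//; last 2 first.
  - exact/measurable_EFinP.
  - by move=> w _; rewrite lee_fin.
  by rewrite [in leRHS]mulrC [leRHS]EFinM lee_wpmul2l// lee_fin expR_ge0.
move: PC; rewrite probability_setC// EFinB.
have : P E \is a fin_num by rewrite fin_num_measure.
case: (P E) => // p _; rewrite -!EFinB !lee_fin; lra.
Qed.

End regret_bound.

(** An infinite minimum makes the left side -oo, whatever [a] is; only finite values call for the
    hypothesis. *)
Lemma lee_sub_bigmin (R : realType) (M : nat) (a c : \bar R) (F : 'I_M -> \bar R) :
  (forall j, 0 <= F j)%E -> (forall j, a <= c + F j)%E ->
  (a - \big[Order.min/+oo]_(j < M) F j <= c)%E.
Proof.
move=> F0 h; elim/big_ind : _ => [|u v hu hv|j _].
- by rewrite addeNy leNye.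
- by rewrite /Order.min; case: ifP.
- have := h j; have := F0 j; case: (F j) => [r _ h'| _ _|].
  + by rewrite leeBlDr.
  + by rewrite addeNy leNye.
  + by rewrite leNgt ltNy0.
Qed.

Theorem theorem3p1 (R : realType) :
  exists C1 C2 C3 : R, [/\ 0 < C1, 0 < C2 & 0 < C3] /\
  forall (n M : nat) (sigma : R) (mu : 'cV[R]_n)
    (d : measure_display) (T : measurableType d) (P : probability T R)
    (eps : 'I_n -> {RV P >-> R}) (y : T -> 'cV[R]_n)
    (A : 'I_M -> 'M[R]_n) (theta : T -> 'cV[R]_M),
  (1 <= n)%N -> (1 <= M)%N -> 0 < sigma ->
  isotropic_gaussian sigma eps ->
  (forall w, y w = mu + \col_i eps i w) ->
  ordered_linear_smoothers A ->
  (forall w, argmin (@simplex R M) (Qagg_criterion sigma A (y w)) (theta w)) ->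
  let loss (B : 'M[R]_n) (w : T) : R := enorm (B *m y w - mu) ^+ 2 in
  let agg_loss (w : T) : R := loss (Amix A (theta w)) w in
  ('E_P[agg_loss] - \big[Order.min/+oo]_(j < M) 'E_P[loss (A j)]
     <= (C1 * sigma ^+ 2)%:E)%E
  /\
  (forall jstar : 'I_M,
     argmin [set: 'I_M] (fun j => 'E_P[loss (A j)]%E) jstar ->
   forall x : R, 1 <= x ->
     ((1 - C3 * expR (- x))%:E <=
      P [set w | (agg_loss w - loss (A jstar) w <= C2 * sigma ^+ 2 * x)%R])%E).
Proof.
(* 64^2 is the inverse of the exponent at which the regret has its exponential moment. *)
exists (64 ^+ 2 * regret_constant R), (64 ^+ 2), (regret_constant R).
have C0 := regret_constant_gt0 R.
have t0 : 0 < 64 ^+ 2 :> R by rewrite exprn_gt0.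
split; first by split => //; rewrite mulr_gt0.
move=> n M sigma mu d T P eps y A theta _ _ s0 gauss yE ordA opt loss agg_loss.
split=> [|jstar _ x _]; last exact: (regret_tail s0 gauss yE ordA opt).
apply: lee_sub_bigmin => j; last exact: (expected_regret_le s0 gauss yE ordA opt).
by rewrite unlock integral_ge0// => w _; rewrite lee_fin sqr_ge0.
Qed.
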